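(* Let $A_1,A_2,A_3,A_4$, $B_1,B_2,B_3,B_4$ and $B$ be given matrices over $\mathbb{H}$ of sizes such that the equation $$A_{1}X_{1}+X_{2}B_{1}+A_{2}Y_{1}B_{2}+A_{3}Y_{2}B_{3}+A_{4}Y_{3}B_{4}=B \qquad (\star)$$ in the unknown quaternion matrices $X_1,X_2,Y_1,Y_2,Y_3$ makes sense. Let $C_i,D_i,E_i$ $(i=1,2,3,4)$, $E$, $E_{22}$, $E_{33}$ be the matrices built from these data as in the context. Then the following statements are equivalent: (1) Equation $(\star)$ is consistent (has a solution over $\mathbb{H}$). (2) $R_{C_i}E_i=0$ and $E_iL_{D_i}=0$ for $i=1,2,3,4$, and $R_{E_{22}}EL_{E_{33}}=0$. (3) All of the following nine rank equalities hold: $$r\begin{pmatrix} B & A_2 & A_3 & A_4 & A_1\\ B_1&0&0&0&0\end{pmatrix}=r(B_1)+r(A_2,A_3,A_4,A_1),$$ $$r\begin{pmatrix} B & A_2 & A_4 & A_1\\ B_3&0&0&0\\ B_1&0&0&0\end{pmatrix}=r(A_2,A_4,A_1)+r\begin{pmatrix} B_3\\ B_1\end{pmatrix},$$ $$r\begin{pmatrix} B & A_3 & A_4 & A_1\\ B_2&0&0&0\\ B_1&0&0&0\end{pmatrix}=r(A_3,A_4,A_1)+r\begin{pmatrix} B_2\\ B_1\end{pmatrix},$$ $$r\begin{pmatrix} B & A_4 & A_1\\ B_2&0&0\\ B_3&0&0\\ B_1&0&0\end{pmatrix}=r\begin{pmatrix} B_2\\ B_3\\ B_1\end{pmatrix}+r(A_4,A_1),$$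 $$r\begin{pmatrix} B & A_2 & A_3 & A_1\\ B_4&0&0&0\\ B_1&0&0&0\end{pmatrix}=r(A_2,A_3,A_1)+r\begin{pmatrix} B_4\\ B_1\end{pmatrix},$$ $$r\begin{pmatrix} B & A_2 & A_1\\ B_3&0&0\\ B_4&0&0\\ B_1&0&0\end{pmatrix}=r\begin{pmatrix} B_3\\ B_4\\ B_1\end{pmatrix}+r(A_2,A_1),$$ $$r\begin{pmatrix} B & A_3 & A_1\\ B_2&0&0\\ B_4&0&0\\ B_1&0&0\end{pmatrix}=r\begin{pmatrix} B_2\\ B_4\\ B_1\end{pmatrix}+r(A_3,A_1),$$ $$r\begin{pmatrix} B & A_1\\ B_2&0\\ B_3&0\\ B_4&0\\ B_1&0\end{pmatrix}=r\begin{pmatrix} B_2\\ B_3\\ B_4\\ B_1\end{pmatrix}+r(A_1),$$ $$r\begin{pmatrix} B & A_2 & A_1 & 0&0&0&A_4\\ B_3&0&0&0&0&0&0\\ B_1&0&0&0&0&0&0\\ 0&0&0&-B&A_3&A_1&A_4\\ 0&0&0&B_2&0&0&0\\ 0&0&0&B_1&0&0&0\\ B_4&0&0&B_4&0&0&0\end{pmatrix} =r\begin{pmatrix} B_3&0\\ B_1&0\\ 0&B_2\\ 0&B_1\\ B_4&B_4\end{pmatrix}+r\begin{pmatrix} A_2&A_1&0&0&A_4\\ 0&0&A_3&A_1&A_4\end{pmatrix}.$$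
   Context: $\mathbb{H}$ is the Hamilton quaternion algebra over $\mathbb{R}$. For a quaternion matrix $A$, $A^*$ is its conjugate transpose, $r(A)$ its rank, and $A^\dagger$ its Moore--Penrose inverse, i.e. the unique $Y$ with $AYA=A$, $YAY=Y$, $(AY)^*=AY$, $(YA)^*=YA$. Put $L_A=I-A^\dagger A$ and $R_A=I-AA^\dagger$. $I$ and $0$ denote identity and zero matrices of appropriate sizes; $(P,Q)$ denotes the block row matrix. Definitions, given $A_1,\dots,A_4,B_1,\dots,B_4,B$: $A_{11}=R_{A_1}A_2$, $A_{22}=R_{A_1}A_3$, $A_{33}=R_{A_1}A_4$, $B_{11}=B_2L_{B_1}$, $B_{22}=B_3L_{B_1}$, $B_{33}=B_4L_{B_1}$, $N_1=B_{22}L_{B_{11}}$, $M_1=R_{A_{11}}A_{22}$, $T_1=R_{A_1}BL_{B_1}$; $C=R_{M_1}R_{A_{11}}$, $C_1=CA_{33}$, $C_2=R_{A_{11}}A_{33}$, $C_3=R_{A_{22}}A_{33}$, $C_4=A_{33}$; $D=L_{B_{11}}L_{N_1}$, $D_1=B_{33}$, $D_2=B_{33}L_{B_{22}}$, $D_3=B_{33}L_{B_{11}}$, $D_4=B_{33}D$; $E_1=CT_1$, $E_2=R_{A_{11}}T_1L_{B_{22}}$, $E_3=R_{A_{22}}T_1L_{B_{11}}$, $E_4=T_1D$; $C_{11}=(L_{C_2},\,L_{C_4})$, $D_{11}=\begin{pmatrix} R_{D_1}\\ R_{D_3}\end{pmatrix}$, $D_{22}=R_{D_2}$, $C_{33}=L_{C_3}$,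 $E_{22}=R_{C_{11}}C_{33}$, $E_{33}=D_{22}L_{D_{11}}$; $F_1=C_1^\dagger E_1D_1^\dagger+L_{C_1}C_2^\dagger E_2D_2^\dagger$, $F_2=C_3^\dagger E_3D_3^\dagger+L_{C_3}C_4^\dagger E_4D_4^\dagger$, $F=F_2-F_1$, $E=R_{C_{11}}FL_{D_{11}}$. *)

(* Defs.v *)
From HB Require Import structures.
From mathcomp Require Import all_boot all_order all_algebra.
From mathcomp Require Import boolp classical_sets reals.
From mathcomp.algebra_tactics Require Import ring.

Set Implicit Arguments.
Unset Strict Implicit.
Unset Printing Implicit Defensive.

Import GRing.Theory.
Local Open Scope ring_scope.

(* [Quat a b c d] is a + b i + c j + d k with real a, b, c, d. *)
Record quat (R : realType) : Type :=
  Quat { q0 : R; q1 : R; q2 : R; q3 : R }.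

Definition quat_tuple (R : realType) (x : quat R) : R * R * R * R :=
  (q0 x, q1 x, q2 x, q3 x).

Definition tuple_quat (R : realType) (t : R * R * R * R) : quat R :=
  Quat t.1.1.1 t.1.1.2 t.1.2 t.2.

Lemma quat_tupleK (R : realType) :
  cancel (@quat_tuple R) (@tuple_quat R).
Proof. by case. Qed.

HB.instance Definition _ (R : realType) :=
  Choice.copy (quat R) (can_type (@quat_tupleK R)).

Definition quat_add (R : realType) (x y : quat R) : quat R :=
  Quat (q0 x + q0 y) (q1 x + q1 y) (q2 x + q2 y) (q3 x + q3 y).

Definition quat_opp (R : realType) (x : quat R) : quat R :=
  Quat (- q0 x) (- q1 x) (- q2 x) (- q3 x).

(* i^2 = j^2 = k^2 = ijk = -1 *)
Definition quat_mul (R : realType) (x y : quat R) : quat R :=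
  Quat (q0 x * q0 y - q1 x * q1 y - q2 x * q2 y - q3 x * q3 y)
       (q0 x * q1 y + q1 x * q0 y + q2 x * q3 y - q3 x * q2 y)
       (q0 x * q2 y - q1 x * q3 y + q2 x * q0 y + q3 x * q1 y)
       (q0 x * q3 y + q1 x * q2 y - q2 x * q1 y + q3 x * q0 y).

Definition quat_conj (R : realType) (x : quat R) : quat R :=
  Quat (q0 x) (- q1 x) (- q2 x) (- q3 x).

Lemma quat_addA (R : realType) : associative (@quat_add R).
Proof. by move=> x y z; rewrite /quat_add /= !addrA. Qed.

Lemma quat_addC (R : realType) : commutative (@quat_add R).
Proof. by move=> x y; congr Quat; apply: addrC. Qed.

Lemma quat_add0 (R : realType) : left_id (Quat 0 0 0 0) (@quat_add R).
Proof. by case=> a b c d; rewrite /quat_add /= !add0r. Qed.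

Lemma quat_addN (R : realType) :
  left_inverse (Quat 0 0 0 0) (@quat_opp R) (@quat_add R).
Proof. by case=> a b c d; rewrite /quat_add /= !addNr. Qed.

HB.instance Definition _ (R : realType) :=
  GRing.isZmodule.Build (quat R)
    (@quat_addA R) (@quat_addC R) (@quat_add0 R) (@quat_addN R).

Lemma quat_mulA (R : realType) : associative (@quat_mul R).
Proof. by move=> x y z; rewrite /quat_mul /=; congr Quat; ring. Qed.

Lemma quat_mul1l (R : realType) : left_id (Quat 1 0 0 0) (@quat_mul R).
Proof. by case=> a b c d; rewrite /quat_mul /=; congr Quat; ring. Qed.

Lemma quat_mul1r (R : realType) : right_id (Quat 1 0 0 0) (@quat_mul R).
Proof. by case=> a b c d; rewrite /quat_mul /=; congr Quat; ring. Qed.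

Lemma quat_mulDl (R : realType) : left_distributive (@quat_mul R) +%R.
Proof.
by move=> x y z; rewrite /GRing.add /= /quat_mul /quat_add /=; congr Quat; ring.
Qed.

Lemma quat_mulDr (R : realType) : right_distributive (@quat_mul R) +%R.
Proof.
by move=> x y z; rewrite /GRing.add /= /quat_mul /quat_add /=; congr Quat; ring.
Qed.

Lemma quat_1neq0 (R : realType) : (Quat 1 0 0 0 : quat R) != 0.
Proof. by apply/eqP => -[] /eqP; rewrite oner_eq0. Qed.

HB.instance Definition _ (R : realType) :=
  GRing.Zmodule_isNzRing.Build (quat R)
    (@quat_mulA R) (@quat_mul1l R) (@quat_mul1r R) (@quat_mulDl R) (@quat_mulDr R) (@quat_1neq0 R).

Definition ctrmx (R : realType) (m n : nat) (A : 'M[quat R]_(m, n)) :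
  'M[quat R]_(n, m) := map_mx (@quat_conj R) A^T.

(* The library's \rank is only available over a commutative field.  In
   [A *m c] the coefficients multiply the columns on the right, so this is
   right linear independence over the quaternions. *)
Definition cols_rfree (R : realType) (m n : nat) (A : 'M[quat R]_(m, n))
    (S : {set 'I_n}) : Prop :=
  forall c : 'cV[quat R]_n,
    (forall j, j \notin S -> c j 0 = 0) -> A *m c = 0 -> c = 0.

(* Maximal number of right linearly independent columns. *)
Definition qrank (R : realType) (m n : nat) (A : 'M[quat R]_(m, n)) : nat :=
  \max_(S : {set 'I_n} | `[< cols_rfree A S >]) #|S|.

Definition is_mpinv (R : realType) (m n : nat) (A : 'M[quat R]_(m, n))
    (Y : 'M[quat R]_(n, m)) : Prop :=
  [/\ A *m Y *m A = A, Y *m A *m Y = Y,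
      ctrmx (A *m Y) = A *m Y & ctrmx (Y *m A) = Y *m A].

(* Exactly one Y satisfies [is_mpinv A Y], for every A; the default value 0
   of xget is never used. *)
Definition mpinv (R : realType) (m n : nat) (A : 'M[quat R]_(m, n)) :
  'M[quat R]_(n, m) := xget 0 [set Y | is_mpinv A Y]%classic.

Definition Lp (R : realType) (m n : nat) (A : 'M[quat R]_(m, n)) :
  'M[quat R]_n := 1%:M - mpinv A *m A.

Definition Rp (R : realType) (m n : nat) (A : 'M[quat R]_(m, n)) :
  'M[quat R]_m := 1%:M - A *m mpinv A.

(* Main.v *)
Require Import Defs.
From mathcomp Require Import all_boot all_order all_fingroup all_algebra.
From mathcomp Require Import boolp reals.
From mathcomp.algebra_tactics Require Import ring.
From mathcomp Require Import lra.

(** Multiplying by [Rp A1] and [Lp B1] eliminates X1 and X2. For fixed Y3, what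
    remains is a two-term equation in Y1, Y2, which is solvable iff Y3 solves
    the four equations C_i Y3 D_i = E_i. Regard these as prescribing Y3 on the
    column space of D_i modulo the kernel of C_i. When the range conditions
    hold, the prescriptions for 1, 2 (met by F1) and for 3, 4 (met by F2) can be
    glued iff F2 - F1 maps im D_2 :&: im D_3 into ker C_2 + ker C_3, which is the last
    projector condition; all other compatibilities are automatic.

    On the rank side, r(B A; D 0) = r(A) + r(D) + r(R_A B L_D), so each rank
    equality says that B maps ker D into im A; iterated projectors such as
    R_(R_A1 A2) R_A1 annihilate exactly the column space of (A2, A1). *)

Set Implicit Arguments.
Unset Strict Implicit.
Unset Printing Implicit Defensive.

Import GRing.Theory Num.Theory.

Local Open Scope ring_scope.

(** * Rank and Moore-Penrose inverse of quaternion matrices *)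

Section QuaternionMatrices.

Variable R : realType.

Local Notation H := (quat R).

(** Rank over a skew field is handled by factorizations A = P Q with P left invertible and Q right
    invertible: exhibiting one, together with its one-sided inverses, certifies the inner size as
    the rank.

    A product of projectors enters a condition L E U = 0 only through the kernel of L and the image
    of U. Conditions are therefore compared by comparing these spaces, for any choice of inner
    inverses A A^- A = A, and never by identities between generalized inverses.

    Gluing leads back to an equation of the kind already solved. F1 may be changed by L_C2 X1 + L_C1
    Y1 R_D2 without spoiling equations 1 and 2, and F2 by - (X2 R_D3 + L_C3 Y2 R_D4) without
    spoiling 3 and 4. The changed matrices agree exactly when L_C2 X1 + X2 R_D3 + L_C1 Y1 R_D2 +
    L_C3 Y2 R_D4 = F, so [five_term_solvable] serves twice: for Y1, Y2 given Y3, and for this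
    equation. *)

Lemma quat_eq (x y : H) :
  q0 x = q0 y -> q1 x = q1 y -> q2 x = q2 y -> q3 x = q3 y -> x = y.
Proof. by case: x y => [a b c d] [a' b' c' d'] /= -> -> -> ->. Qed.

Lemma quat_conjM (x y : H) : quat_conj (x * y) = quat_conj y * quat_conj x.
Proof. by apply: quat_eq; rewrite /=; ring. Qed.

Lemma quat_conjD (x y : H) : quat_conj (x + y) = quat_conj x + quat_conj y.
Proof. by apply: quat_eq; rewrite /=; ring. Qed.

Lemma quat_conj0 : quat_conj (0 : H) = 0.
Proof. by apply: quat_eq; rewrite /= ?oppr0. Qed.

Lemma quat_conjK : involutive (@quat_conj R).
Proof. by move=> x; apply: quat_eq; rewrite /= ?opprK. Qed.

Definition quat_normsq (x : H) : R :=
  q0 x ^+ 2 + q1 x ^+ 2 + q2 x ^+ 2 + q3 x ^+ 2.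

Lemma quat_normsq_ge0 x : 0 <= quat_normsq x.
Proof. by rewrite /quat_normsq !addr_ge0 ?sqr_ge0. Qed.

Lemma quat_normsq_eq0 x : quat_normsq x = 0 -> x = 0.
Proof.
rewrite /quat_normsq => x0.
have := sqr_ge0 (q0 x); have := sqr_ge0 (q1 x).
have := sqr_ge0 (q2 x); have := sqr_ge0 (q3 x) => h3 h2 h1 h0.
by apply: quat_eq; apply/eqP; rewrite -sqrf_eq0; apply/eqP => /=; lra.
Qed.

Lemma quat_inverse (x : H) : x != 0 -> exists y : H, y * x = 1 /\ x * y = 1.
Proof.
move=> x0; have n0 : quat_normsq x != 0 by apply: contra_neq x0 => /quat_normsq_eq0.
exists (Quat (q0 x / quat_normsq x) (- q1 x / quat_normsq x)
             (- q2 x / quat_normsq x) (- q3 x / quat_normsq x)).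
by split; apply: quat_eq; rewrite /= /quat_normsq in n0 *; field.
Qed.

(** * Conjugate transpose and positivity *)

Lemma ctrmxM m n p (A : 'M[H]_(m, n)) (B : 'M[H]_(n, p)) :
  ctrmx (A *m B) = ctrmx B *m ctrmx A.
Proof.
apply/matrixP => i j; rewrite !mxE (big_morph _ quat_conjD quat_conj0).
by apply: eq_bigr => k _; rewrite !mxE quat_conjM.
Qed.

Lemma ctrmxK m n (A : 'M[H]_(m, n)) : ctrmx (ctrmx A) = A.
Proof. by apply/matrixP => i j; rewrite !mxE quat_conjK. Qed.

Lemma ctrmx0 m n : ctrmx (0 : 'M[H]_(m, n)) = 0.
Proof. by apply/matrixP => i j; rewrite !mxE quat_conj0. Qed.

(** The real part of the j-th diagonal entry of the product is the sum of the squared norms of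
    column j of [A]. *)
Lemma mul_ctrmx_eq0 m n (A : 'M[H]_(m, n)) : ctrmx A *m A = 0 -> A = 0.
Proof.
move=> AA0; apply/matrixP => i j; rewrite mxE; apply: quat_normsq_eq0.
have q0D (x y : H) : q0 (x + y) = q0 x + q0 y by [].
have /(congr1 (@q0 R)) := congr1 (fun M : 'M_n => M j j) AA0.
rewrite !mxE (big_morph _ q0D (erefl : q0 (0 : H) = 0)).
under eq_bigr => k _ do rewrite !mxE.
have E k : q0 (quat_conj (A k j) * A k j) = quat_normsq (A k j).
  by rewrite /quat_normsq /=; ring.
under eq_bigr => k _ do rewrite E.
move/eqP; rewrite psumr_eq0 => [/allP /(_ i)|k _]; last exact: quat_normsq_ge0.
by rewrite mem_index_enum => /(_ isT) /eqP.
Qed.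

Lemma mul_ctrmx_cancel m n p (A : 'M[H]_(m, n)) (X : 'M[H]_(n, p)) :
  ctrmx A *m (A *m X) = 0 -> A *m X = 0.
Proof.
by move=> AAX; apply: mul_ctrmx_eq0; rewrite ctrmxM -mulmxA AAX mulmx0.
Qed.

(** * Rank factorizations over the quaternions *)

Lemma perm_mxKV n (s : 'S_n) : perm_mx s *m perm_mx (s^-1)%g = 1%:M :> 'M[H]_n.
Proof. by rewrite -perm_mxM mulgV perm_mx1. Qed.

Lemma perm_mxVK n (s : 'S_n) : perm_mx (s^-1)%g *m perm_mx s = 1%:M :> 'M[H]_n.
Proof. by rewrite -perm_mxM mulVg perm_mx1. Qed.

Lemma mulmx_scalarK n (a b : H) :
  a * b = 1 -> a%:M *m b%:M = 1%:M :> 'M[H]_n.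
Proof. by move=> ab; rewrite -scalar_mxM ab. Qed.

(** Invariant basis number, by elimination: once a nonzero entry of the first column of [V] is moved
    to the corner, the lower right block of [U] is a left inverse of the Schur complement of that
    entry in [V], and both sizes drop by one. *)
Lemma leq_dim_mulmx1 r s (U : 'M[H]_(r, s)) (V : 'M[H]_(s, r)) :
  U *m V = 1%:M -> (r <= s)%N.
Proof.
elim: s r U V => [|s IHs] [|r] U V UV //.
  have /matrixP/(_ 0 0)/eqP := UV.
  by rewrite mxE big_ord0 mxE eq_sym oner_eq0.
have [i Vi0] : exists i, V i 0 != 0.
  apply: contrapT => V0; have /matrixP/(_ 0 0)/eqP := UV.
  rewrite mxE big1 => [|i _]; first by rewrite mxE eq_sym oner_eq0.
  suff -> : V i 0 = 0 by rewrite mulr0.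
  by apply/eqP; apply: contraPT V0 => Vi0; apply; exists i.
wlog i0 : i U V UV Vi0 / i = 0.
  pose t := tperm i 0 => W.
  apply: (W 0 (U *m perm_mx (t^-1)%g) (perm_mx t *m V)) => //.
    by rewrite mulmxA -(mulmxA U) perm_mxVK mulmx1.
  by rewrite -row_permE mxE tpermR.
have [y [_ ay]] := quat_inverse Vi0.
rewrite {}i0 in ay.
move: U V UV ay {Vi0}; rewrite -[r.+1]/(1 + r)%N -[s.+1]/(1 + s)%N => U V UV ay.
have := UV; rewrite -{1}[U]submxK -{1}[V]submxK mulmx_block scalar_mx_block.
move=> /eq_block_mx[_ _ xayc xbyd].
set x := dlsubmx U in xayc xbyd; set z := drsubmx U in xayc xbyd.
set a := ulsubmx V in xayc; set c := dlsubmx V in xayc.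
set b := ursubmx V in xbyd; set d := drsubmx V in xbyd.
have aE : a = (V 0 0)%:M.
  rewrite [a]mx11_scalar !mxE; congr (V _ _)%:M; exact/val_inj.
have xE : x = - (z *m c *m (y%:M)).
  rewrite -[LHS]mulmx1 -(mulmx_scalarK 1 ay) -aE mulmxA -mulNmx.
  by congr (_ *m _); apply/eqP; rewrite -addr_eq0 xayc.
apply: (IHs _ z (d - c *m y%:M *m b)).
rewrite mulmxBr -xbyd xE mulNmx !mulmxA; exact: addrC.
Qed.

(** Gaussian elimination: a nonzero pivot a is moved to the corner and the Schur complement d - c
    a^-1 b is factored by induction. The zero matrix factors through dimension 0. *)
Lemma rank_factorization m n (A : 'M[H]_(m, n)) :
  exists r (P : 'M[H]_(m, r)) (P' : 'M[H]_(r, m))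
           (Q : 'M[H]_(r, n)) (Q' : 'M[H]_(n, r)),
    [/\ A = P *m Q, P' *m P = 1%:M & Q *m Q' = 1%:M].
Proof.
have zero k l : exists r (P : 'M[H]_(k, r)) (P' : 'M[H]_(r, k))
    (Q : 'M[H]_(r, l)) (Q' : 'M[H]_(l, r)),
    [/\ (0 : 'M[H]_(k, l)) = P *m Q, P' *m P = 1%:M & Q *m Q' = 1%:M].
  exists 0%N, 0, 0, 0, 0; split; first by rewrite mulmx0.
    by apply/matrixP => -[].
  by apply/matrixP => -[].
elim: m n A => [|m IHm] n A; first by rewrite [A]flatmx0; exact: zero.
have [->|/eqP A0] := pselect (A = 0); first exact: zero.
have [i [j Aij]] : exists i j, A i j != 0.
  apply: contrapT => N; move/eqP: A0; apply; apply/matrixP => i j.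
  by rewrite mxE; apply/eqP; apply: contraPT N => Aij; apply; exists i, j.
case: n => [|n] in A A0 i j Aij *; first by have := ltn_ord j.
wlog [i0 j0] : i j A {A0} Aij / i = 0 /\ j = 0.
  pose t := tperm i 0; pose u := tperm j 0 => W.
  have [||r [P [P' [Q [Q' [AE PP QQ]]]]]] :=
    W 0 0 (perm_mx t *m A *m perm_mx (u^-1)%g).
  - by rewrite -row_permE -col_permE !mxE !tpermR.
  - by [].
  exists r, (perm_mx (t^-1)%g *m P), (P' *m perm_mx t),
    (Q *m perm_mx u), (perm_mx (u^-1)%g *m Q'); split.
  - by rewrite !mulmxA -(mulmxA _ P) -AE !mulmxA perm_mxVK mul1mx
      -!mulmxA perm_mxVK mulmx1.
  - by rewrite mulmxA -(mulmxA P') perm_mxKV mulmx1.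
  - by rewrite mulmxA -(mulmxA Q) perm_mxKV mulmx1.
have [y [ya ay]] := quat_inverse Aij.
rewrite {}i0 {}j0 in ay ya.
move: A ay ya {Aij}; rewrite -[m.+1]/(1 + m)%N -[n.+1]/(1 + n)%N => A ay ya.
have aE : ulsubmx A = (A 0 0)%:M.
  rewrite [LHS]mx11_scalar !mxE; congr (A _ _)%:M; exact/val_inj.
rewrite -[A]submxK aE.
set a := A 0 0 in ay ya *.
set b := ursubmx A; set c := dlsubmx A; set d := drsubmx A.
have [r [P [P' [Q [Q' [SE PP QQ]]]]]] := IHm _ (d - c *m y%:M *m b).
exists (1 + r)%N, (block_mx 1%:M 0 (c *m y%:M) P),
  (block_mx 1%:M 0 (- (P' *m c *m y%:M)) P'), (block_mx a%:M b 0 Q),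
  (block_mx y%:M (- (y%:M *m b *m Q')) 0 Q').
rewrite !mulmx_block !(mul1mx, mul0mx, mulmx0, mulmx1, addr0, add0r, mulNmx).
rewrite -SE PP QQ mulmxA addNr -scalar_mx_block -!mulmxA.
rewrite !(mulmx_scalarK _ ay) mulmxN !(mulmxA a%:M) (mulmx_scalarK _ ay).
rewrite (mulmx_scalarK _ ya) mulmx1 mul1mx addNr subrKC.
by rewrite -scalar_mx_block.
Qed.

Lemma left_invertible_of_injective r s (V : 'M[H]_(r, s)) :
  (forall c : 'cV[H]_s, V *m c = 0 -> c = 0) ->
  exists U : 'M[H]_(s, r), U *m V = 1%:M.
Proof.
have [k [P [P' [Q [Q' [-> PP QQ]]]]]] := rank_factorization V => inj.
exists (Q' *m P'); rewrite mulmxA -(mulmxA Q') PP mulmx1.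
apply/esym/eqP; rewrite -subr_eq0; apply/eqP/matrixP => i j.
(* Every column of 1 - Q' Q is killed by Q, hence by P Q, and injectivity applies. *)
suff /matrixP/(_ i 0) : col j (1%:M - Q' *m Q) = 0 by rewrite !mxE.
apply: inj; rewrite colE !mulmxA mulmxBr mulmx1 !mulmxA -(mulmxA P) QQ.
by rewrite mulmx1 subrr mul0mx.
Qed.

Definition coord_incl n (S : {set 'I_n}) : 'M[H]_(n, #|S|) :=
  \matrix_(i, k) (i == enum_val k)%:R.

Lemma coord_incl_in n (S : {set 'I_n}) p (V : 'M[H]_(#|S|, p)) k j :
  (coord_incl S *m V) (enum_val k) j = V k j.
Proof.
rewrite mxE (bigD1 k) //= mxE eqxx mul1r big1 ?addr0 // => l /negPf lk.
by rewrite mxE (inj_eq enum_val_inj) eq_sym lk mul0r.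
Qed.

Lemma coord_incl_out n (S : {set 'I_n}) p (V : 'M[H]_(#|S|, p)) i j :
  i \notin S -> (coord_incl S *m V) i j = 0.
Proof.
move=> iS; rewrite mxE big1 // => l _; rewrite mxE.
by case: eqP iS => [->|]; rewrite ?enum_valP ?mul0r.
Qed.

Lemma coord_inclP n (S : {set 'I_n}) p (K : 'M[H]_(n, p)) :
  (forall i j, i \notin S -> K i j = 0) ->
  exists V : 'M[H]_(#|S|, p), K = coord_incl S *m V.
Proof.
move=> K0; exists (\matrix_(k, j) K (enum_val k) j); apply/matrixP => i j.
have [iS|iS] := boolP (i \in S); last by rewrite coord_incl_out // K0.
by rewrite -(enum_rankK_in iS iS) coord_incl_in mxE.
Qed.

(** [K] writes every column of [A] as a right combination of the columns in a free set of maximal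
    size. *)
Lemma maximal_cols_rfree m n (A : 'M[H]_(m, n)) :
  exists2 S : {set 'I_n}, cols_rfree A S &
    exists2 K : 'M[H]_n, A *m K = A & forall i j, i \notin S -> K i j = 0.
Proof.
have free0 : `[< cols_rfree A set0 >].
  apply/asboolP => c c0 _; apply/colP => j.
  by rewrite c0 ?mxE // in_set0.
case: (@arg_maxnP _ set0 (fun S => `[< cols_rfree A S >])
  (fun S : {set 'I_n} => #|S|) free0) => S /asboolP freeS maxS.
exists S => //.
have /choice[k kP] : forall j, exists c : 'cV[H]_n,
    A *m c = col j A /\ forall i, i \notin S -> c i 0 = 0.
  move=> j; rewrite colE; have [jS|jS] := boolP (j \in S).
    exists (delta_mx j 0); split=> // i iS; rewrite mxE.
    by case: eqP iS => // ->; rewrite jS.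
  have [c [cS Ac c0]] : exists c : 'cV[H]_n,
      [/\ forall i, i \notin j |: S -> c i 0 = 0, A *m c = 0 & c <> 0].
    apply: contrapT => N; have /maxS : `[< cols_rfree A (j |: S) >].
      by apply/asboolP => c cS Ac; apply: contrapT => c0; apply: N; exists c.
    by rewrite /= cardsU1 jS ltnn.
  have cj : c j 0 != 0.
    apply: contra_notN c0 => /eqP cj; apply: freeS => // i iS.
    by have [->//|ij] := eqVneq i j; rewrite cS // in_setU1 negb_or ij.
  have [y [_ cy]] := quat_inverse cj.
  (* Scaling the relation on the right keeps it a relation among columns and turns its entry at [j]
     into 1, so the difference is supported in [S]. *)
  exists (delta_mx j 0 - c *m y%:M); split=> [|i iS].
    by rewrite mulmxBr (mulmxA A) Ac mul0mx subr0.
  rewrite !mxE big_ord1 mxE eqxx mulr1n; have [->|ij] := eqVneq i j.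
    by rewrite cy subrr.
  by rewrite cS ?in_setU1 ?negb_or ?ij // mul0r subrr.
exists (\matrix_(i, j) k j i 0) => [|i j iS]; last by rewrite mxE (kP j).2.
apply/matrixP => i j; have /colP/(_ i) := (kP j).1; rewrite !mxE => <-.
by apply: eq_bigr => l _; rewrite mxE.
Qed.

(** Both bounds come from [leq_dim_mulmx1]. For a free set S, [Q] restricted to S is injective,
    hence left invertible, so S has at most r elements. For a maximal S, A K = A gives Q K Q' = 1,
    so the identity of size r factors through S. *)
Lemma qrank_factorization m n r (A : 'M[H]_(m, n))
    (P : 'M[H]_(m, r)) P' (Q : 'M[H]_(r, n)) Q' :
  A = P *m Q -> P' *m P = 1%:M -> Q *m Q' = 1%:M -> qrank A = r.
Proof.
move=> AE PP QQ; apply/eqP; rewrite eqn_leq; apply/andP; split.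
  apply/bigmax_leqP => S /asboolP freeS.
  have [c AS0|U] := @left_invertible_of_injective _ _ (Q *m coord_incl S).
    have Sc0 : coord_incl S *m c = 0.
      apply: freeS => [j jS|]; first exact: coord_incl_out.
      by rewrite AE -mulmxA (mulmxA Q) AS0 mulmx0.
    by apply/colP => k; rewrite -coord_incl_in Sc0 !mxE.
  by move=> UE; apply: leq_dim_mulmx1 UE.
have [S freeS [K AK KS]] := maximal_cols_rfree A.
have [V VE] := coord_inclP KS.
have freeSb : `[< cols_rfree A S >] by apply/asboolP.
have leS : (#|S| <= qrank A)%N.
  exact: (@leq_bigmax_cond _ (fun S => `[< cols_rfree A S >])
    (fun S : {set 'I_n} => #|S|)).
apply: leq_trans leS.
apply: (@leq_dim_mulmx1 _ _ (Q *m coord_incl S) (V *m Q')).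
by rewrite mulmxA -(mulmxA Q) -VE -[Q]mul1mx -PP -(mulmxA P') -AE -(mulmxA P')
  AK AE mulmxA PP mul1mx.
Qed.

Lemma qrank_mul_le m n k (X : 'M[H]_(m, k)) (Y : 'M[H]_(k, n)) :
  (qrank (X *m Y) <= k)%N.
Proof.
have [r [P [P' [Q [Q' [AE PP QQ]]]]]] := rank_factorization (X *m Y).
rewrite (qrank_factorization AE PP QQ).
apply: (@leq_dim_mulmx1 _ _ (P' *m X) (Y *m Q')).
by rewrite mulmxA -(mulmxA P') AE mulmxA PP mul1mx.
Qed.

Lemma qrank_mulmx_le m n m' n' (P : 'M[H]_(m', m)) (A : 'M[H]_(m, n))
    (Q : 'M[H]_(n, n')) :
  (qrank (P *m A *m Q) <= qrank A)%N.
Proof.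
have [r [U [U' [V [V' [AE UU VV]]]]]] := rank_factorization A.
rewrite (qrank_factorization AE UU VV) {}AE mulmxA -mulmxA.
exact: qrank_mul_le.
Qed.

Lemma qrank_mx0 m n : qrank (0 : 'M[H]_(m, n)) = 0%N.
Proof.
apply/eqP; rewrite -leqn0; have := qrank_mul_le (0 : 'M_(m, 0)) (0 : 'M_(0, n)).
by rewrite mulmx0.
Qed.

Lemma qrank0_eq0 m n (A : 'M[H]_(m, n)) : qrank A = 0%N -> A = 0.
Proof.
have [r [U [U' [V [V' [AE UU VV]]]]]] := rank_factorization A.
rewrite (qrank_factorization AE UU VV) => r0.
by subst r; rewrite AE [V]flatmx0 mulmx0.
Qed.

(* Zlobec's formula: if G is any generalized inverse of A^* A A^*, then
   A^* G A^* is the Moore-Penrose inverse of A. *)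
Lemma is_mpinv_exists m n (A : 'M[H]_(m, n)) : exists Y, is_mpinv A Y.
Proof.
pose As := ctrmx A; have AsK : ctrmx As = A by exact: ctrmxK.
have [r [P [P' [Q [Q' [HE PP QQ]]]]]] := rank_factorization (As *m A *m As).
pose G := Q' *m P'; pose X := As *m A *m As.
have XGX : X *m G *m X = X.
  by rewrite /X /G HE !mulmxA -(mulmxA P) QQ mulmx1 -(mulmxA P) PP mulmx1.
(* These four cancellation rules are one positivity statement, read for [A] and its adjoint and on
   either side. They strip X G X = X down to X G As = As and As G X = As. *)
have cancel p (Z : 'M[H]_(n, p)) : As *m (A *m Z) = 0 -> A *m Z = 0.
  exact: mul_ctrmx_cancel.
have cancel' p (Z : 'M[H]_(m, p)) : A *m (As *m Z) = 0 -> As *m Z = 0.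
  by move=> h; apply: mul_ctrmx_cancel; rewrite ctrmxK.
have rcancel p (Z : 'M[H]_(p, m)) : Z *m A *m As = 0 -> Z *m A = 0.
  move=> h; rewrite -[LHS]ctrmxK ctrmxM cancel' ?ctrmx0 //.
  rewrite -[LHS]ctrmxK [X in ctrmx X]ctrmxM [ctrmx (As *m _)]ctrmxM.
  by rewrite ctrmxK AsK h ctrmx0.
have rcancel' p (Z : 'M[H]_(p, n)) : Z *m As *m A = 0 -> Z *m As = 0.
  move=> h; rewrite -[LHS]ctrmxK ctrmxM AsK cancel ?ctrmx0 //.
  rewrite -[LHS]ctrmxK [X in ctrmx X]ctrmxM [ctrmx (A *m _)]ctrmxM.
  by rewrite ctrmxK AsK h ctrmx0.
have h1 : X *m G *m As = As.
  apply/eqP; rewrite -subr_eq0 -[X in _ - X]mul1mx -mulmxBl; apply/eqP.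
  apply: rcancel'; apply: rcancel.
  have -> (W : 'M_n) : W *m As *m A *m As = W *m X by rewrite /X !mulmxA.
  by rewrite mulmxBl XGX mul1mx subrr.
have h2 : As *m G *m X = As.
  apply/eqP; rewrite -subr_eq0 -mulmxA -[X in _ - X]mulmx1 -mulmxBr; apply/eqP.
  apply: cancel'; apply: cancel.
  have -> (W : 'M_m) : As *m (A *m (As *m W)) = X *m W by rewrite /X !mulmxA.
  by rewrite mulmxBr mulmxA XGX mulmx1 subrr.
pose Y := As *m G *m As.
have AAY : As *m (A *m Y) = As by rewrite -[RHS]h1 /Y /X !mulmxA.
have YAA : Y *m A *m As = As by rewrite -[RHS]h2 /Y /X !mulmxA.
have hAY : ctrmx (A *m Y) = A *m Y.
  (* The adjoint of A Y has the form of an adjoint times its matrix, which is self-adjoint. *)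
  have E : ctrmx (A *m Y) = ctrmx (A *m Y) *m (A *m Y).
    by rewrite ctrmxM -mulmxA -/As AAY.
  by rewrite -[RHS]ctrmxK [in RHS]E [RHS]ctrmxM ctrmxK -E.
have hYA : ctrmx (Y *m A) = Y *m A.
  have E : ctrmx (Y *m A) = Y *m A *m ctrmx (Y *m A).
    by rewrite ctrmxM mulmxA -/As YAA.
  by rewrite -[RHS]ctrmxK [in RHS]E [RHS]ctrmxM ctrmxK -E.
exists Y; split=> //.
  by rewrite -hAY -{2}[A]ctrmxK -ctrmxM -/As AAY ctrmxK.
have -> : Y *m A *m Y = Y *m A *m As *m G *m As by rewrite {2}/Y !mulmxA.
by rewrite YAA.
Qed.

Lemma mpinvP m n (A : 'M[H]_(m, n)) : is_mpinv A (mpinv A).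
Proof.
have [Y YP] := is_mpinv_exists A.
rewrite /mpinv; case: classical_sets.xgetP => [y -> //|/(_ Y)]; by move/(_ YP).
Qed.

Lemma mpinvK m n (A : 'M[H]_(m, n)) : A *m mpinv A *m A = A.
Proof. by case: (mpinvP A). Qed.

Lemma Rp_mul m n (A : 'M[H]_(m, n)) : Rp A *m A = 0.
Proof. by rewrite mulmxBl mul1mx mpinvK subrr. Qed.

Lemma mul_Lp m n (A : 'M[H]_(m, n)) : A *m Lp A = 0.
Proof. by rewrite mulmxBr mulmx1 mulmxA mpinvK subrr. Qed.

Lemma Rp_idem m n (A : 'M[H]_(m, n)) : Rp A *m Rp A = Rp A.
Proof. by rewrite {2}/Rp mulmxBr mulmx1 mulmxA Rp_mul mul0mx subr0. Qed.

Lemma Lp_idem m n (A : 'M[H]_(m, n)) : Lp A *m Lp A = Lp A.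
Proof. by rewrite {1}/Lp mulmxBl mul1mx -mulmxA mul_Lp mulmx0 subr0. Qed.

Lemma mpinv_Rp m n (A : 'M[H]_(m, n)) : mpinv A *m Rp A = 0.
Proof. by rewrite mulmxBr mulmx1 mulmxA; case: (mpinvP A) => _ ->; rewrite subrr. Qed.

Lemma Lp_mpinv m n (A : 'M[H]_(m, n)) : Lp A *m mpinv A = 0.
Proof. by rewrite mulmxBl mul1mx; case: (mpinvP A) => _ ->; rewrite subrr. Qed.

Lemma qrank_block m n p q (B : 'M[H]_(m, n)) (A : 'M[H]_(m, p))
    (D : 'M[H]_(q, n)) :
  qrank (block_mx B A D 0)
    = (qrank A + qrank D + qrank (Rp A *m B *m Lp D))%N.
Proof.
set Z := Rp A *m B *m Lp D.
have [r [P [P' [Q [Q' [AE PP QQ]]]]]] := rank_factorization A.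
have [s [U [U' [V [V' [DE UU VV]]]]]] := rank_factorization D.
have [t [S [S' [T [T' [ZE SS TT]]]]]] := rank_factorization Z.
rewrite (qrank_factorization AE PP QQ) (qrank_factorization DE UU VV).
rewrite (qrank_factorization ZE SS TT).
have SE : S = Z *m T' by rewrite ZE -mulmxA TT mulmx1.
have TE : T = S' *m Z by rewrite ZE mulmxA SS mul1mx.
have PE : P = A *m Q' by rewrite AE -mulmxA QQ mulmx1.
have VE : V = U' *m D by rewrite DE mulmxA UU mul1mx.
(* The next relations make the ranks add: A A^+ kills S while [Rp A] fixes it and kills P, so P and
   S have independent column spaces. Dually, V and T have independent row spaces. *)
have RS : Rp A *m S = S by rewrite SE /Z !mulmxA Rp_idem.
have TL : T *m Lp D = T by rewrite TE /Z -!mulmxA Lp_idem.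
have RP : Rp A *m P = 0 by rewrite PE mulmxA Rp_mul mul0mx.
have VL : V *m Lp D = 0 by rewrite VE -mulmxA mul_Lp mulmx0.
have mS : mpinv A *m S = 0 by rewrite -RS mulmxA mpinv_Rp mul0mx.
have Tm : T *m mpinv D = 0 by rewrite -TL -mulmxA Lp_mpinv mulmx0.
have AmP : A *m (mpinv A *m P) = P by rewrite PE !mulmxA mpinvK.
have VmD : V *m (mpinv D *m (D *m V')) = V *m V'.
  by rewrite VE -!mulmxA; congr (_ *m _); rewrite !mulmxA mpinvK.
pose X1 := mpinv A *m B; pose Y1 := Rp A *m B *m mpinv D.
have BE : B = A *m X1 + Z + Y1 *m D.
  rewrite /X1 /Z /Y1 -addrA -(mulmxA (Rp A *m B)) -mulmxDr subrK mulmx1.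
  by rewrite mulmxA -mulmxDl subrKC mul1mx.
have -> : (r + s + t = r + (s + t))%N by rewrite addnA.
(* With B = A X1 + Z + Y1 D, the rank factorizations of A, D and Z assemble
   into one of the whole block matrix. *)
apply: (@qrank_factorization _ _ _ _
  (block_mx P (row_mx (Y1 *m U) S) 0 (row_mx U 0))
  (block_mx (P' *m (A *m mpinv A)) (- (P' *m (A *m mpinv A) *m Y1))
    (col_mx 0 (S' *m Rp A)) (col_mx U' (- (S' *m Rp A *m Y1))))
  (block_mx (Q *m X1) Q (col_mx V T) 0)
  (block_mx 0 (row_mx (mpinv D *m D *m V') (Lp D *m T'))
    Q' (- (X1 *m row_mx (mpinv D *m D *m V') (Lp D *m T'))))).
- rewrite mulmx_block !mul_row_col !(mulmx0, mul0mx, addr0, add0r) -DE -ZE.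
  rewrite -AE -mulmxA -DE mulmxA -AE; congr block_mx.
  by rewrite [LHS]BE -addrA [Z + _]addrC.
- rewrite mulmx_block !(mulmx0, mul0mx, addr0, add0r) !mul_mx_row !mul_col_mx.
  rewrite !(mulmx0, mul0mx, mulNmx, addr0, oppr0) -!mulmxA AmP PP RP mS RS.
  rewrite !mulmx0 !add_row_mx !addrN !addr0 add_col_mx add0r addrN UU SS col_mx0.
  by rewrite col_mx0 addr0 row_mx0 -block_mxEh -!scalar_mx_block.
- rewrite mulmx_block !(mulmx0, mul0mx, addr0, add0r) !mul_mx_row !mul_col_mx.
  rewrite -!mulmxA VmD VV !(mulmxA T) Tm TL TT (mulmxA V) VL !(mul0mx, mulmxA).
  by rewrite QQ mulmxN mul_mx_row !mulmxA addrN -block_mxEh -!scalar_mx_block.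
Qed.

Lemma qrank_block_eq m n p q (B : 'M[H]_(m, n)) (A : 'M[H]_(m, p))
    (D : 'M[H]_(q, n)) :
  qrank (block_mx B A D 0) = (qrank A + qrank D)%N <-> Rp A *m B *m Lp D = 0.
Proof.
rewrite qrank_block; split=> [/eqP|->]; last by rewrite qrank_mx0 addn0.
by rewrite -[X in _ == X]addn0 eqn_add2l => /eqP; exact: qrank0_eq0.
Qed.

Lemma qrank_block_eqC m n p q (B : 'M[H]_(m, n)) (A : 'M[H]_(m, p))
    (D : 'M[H]_(q, n)) :
  qrank (block_mx B A D 0) = (qrank D + qrank A)%N <-> Rp A *m B *m Lp D = 0.
Proof. by rewrite (addnC (qrank D)) qrank_block_eq. Qed.

End QuaternionMatrices.

(** * Linear matrix equations over a ring with inner inverses *)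

Section Exactness.

Variable S : pzRingType.

Definition in_cols m p q (X : 'M[S]_(m, q)) (A : 'M[S]_(m, p)) :=
  exists W, X = A *m W.

Definition in_rows n p q (X : 'M[S]_(q, n)) (D : 'M[S]_(p, n)) :=
  exists W, X = W *m D.

Lemma in_cols_refl m p (A : 'M[S]_(m, p)) : in_cols A A.
Proof. by exists 1%:M; rewrite mulmx1. Qed.

Lemma in_cols_rowl m p p' q (X : 'M[S]_(m, q)) (A : 'M[S]_(m, p))
  (B : 'M[S]_(m, p')) : in_cols X A -> in_cols X (row_mx A B).
Proof. by case=> W ->; exists (col_mx W 0); rewrite mul_row_col mulmx0 addr0. Qed.

Lemma in_cols_rowr m p p' q (X : 'M[S]_(m, q)) (A : 'M[S]_(m, p))
  (B : 'M[S]_(m, p')) : in_cols X B -> in_cols X (row_mx A B).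
Proof. by case=> W ->; exists (col_mx 0 W); rewrite mul_row_col mulmx0 add0r. Qed.

Lemma in_cols_row m p q q' (X : 'M[S]_(m, q)) (Y : 'M[S]_(m, q'))
  (A : 'M[S]_(m, p)) : in_cols X A -> in_cols Y A -> in_cols (row_mx X Y) A.
Proof. by case=> W -> [V ->]; exists (row_mx W V); rewrite mul_mx_row. Qed.

Lemma in_rows_refl n p (D : 'M[S]_(p, n)) : in_rows D D.
Proof. by exists 1%:M; rewrite mul1mx. Qed.

Lemma in_rows_colu n p p' q (X : 'M[S]_(q, n)) (A : 'M[S]_(p, n))
  (B : 'M[S]_(p', n)) : in_rows X A -> in_rows X (col_mx A B).
Proof. by case=> W ->; exists (row_mx W 0); rewrite mul_row_col mul0mx addr0. Qed.

Lemma in_rows_cold n p p' q (X : 'M[S]_(q, n)) (A : 'M[S]_(p, n))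
  (B : 'M[S]_(p', n)) : in_rows X B -> in_rows X (col_mx A B).
Proof. by case=> W ->; exists (row_mx 0 W); rewrite mul_row_col mul0mx add0r. Qed.

Lemma in_rows_col n p q q' (X : 'M[S]_(q, n)) (Y : 'M[S]_(q', n))
  (D : 'M[S]_(p, n)) : in_rows X D -> in_rows Y D -> in_rows (col_mx X Y) D.
Proof. by case=> W -> [V ->]; exists (col_mx W V); rewrite mul_col_mx. Qed.

(** Exactness ker L = im A, tested on matrices of every width. It serves on both sides of a
    condition L E U = 0: with [L] as annihilator of a column space, and with the right factor [U] as
    a generator of a kernel. *)
Definition exact_at k m p (L : 'M[S]_(k, m)) (A : 'M[S]_(m, p)) :=
  forall q (X : 'M[S]_(m, q)), L *m X = 0 <-> in_cols X A.

Lemma exact_mul0 k m p (L : 'M[S]_(k, m)) (A : 'M[S]_(m, p)) :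
  exact_at L A -> L *m A = 0.
Proof. by move=> LA; apply/LA/in_cols_refl. Qed.

Lemma exact_eq_cols k m p p' (L : 'M[S]_(k, m)) (A : 'M[S]_(m, p))
    (A' : 'M[S]_(m, p')) :
  exact_at L A -> in_cols A A' -> in_cols A' A -> exact_at L A'.
Proof.
move=> LA [W AE] [W' AE'] q X; rewrite LA; split=> -[V ->].
  by exists (W *m V); rewrite mulmxA -AE.
by exists (W' *m V); rewrite mulmxA -AE'.
Qed.

Lemma exact_eq_rows k k' m p (D : 'M[S]_(k, m)) (D' : 'M[S]_(k', m))
    (U : 'M[S]_(m, p)) :
  exact_at D U -> in_rows D D' -> in_rows D' D -> exact_at D' U.
Proof.
move=> DU [W DE] [W' DE'] q X; rewrite -DU; split=> DX.
  by rewrite DE -mulmxA DX mulmx0.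
by rewrite DE' -mulmxA DX mulmx0.
Qed.

(** The right-hand side mentions only the image of [A] and the kernel of [D], so [L] and [U] may be
    exchanged for any other matrices exact at the same spaces. *)
Lemma exact_mulP k m p n l r (L : 'M[S]_(k, m)) (A : 'M[S]_(m, p))
    (D : 'M[S]_(l, n)) (U : 'M[S]_(n, r)) (E : 'M[S]_(m, n)) :
  exact_at L A -> exact_at D U ->
  (L *m E *m U = 0 <->
   forall q (V : 'M[S]_(n, q)), D *m V = 0 -> in_cols (E *m V) A).
Proof.
move=> LA DU; split=> [LEU q V /DU[W ->]|EV].
  by apply/LA; rewrite !mulmxA LEU mul0mx.
by rewrite -mulmxA LA; apply: EV; exact: exact_mul0.
Qed.

Lemma mul3_eq0 k m p n l r (L : 'M[S]_(k, m)) (A : 'M[S]_(m, p))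
    (D : 'M[S]_(l, n)) (U : 'M[S]_(n, r)) (E : 'M[S]_(m, n)) X Y :
  L *m A = 0 -> D *m U = 0 -> E = A *m X + Y *m D -> L *m E *m U = 0.
Proof.
move=> LA DU ->.
by rewrite mulmxDr mulmxDl !mulmxA LA !mul0mx add0r -!mulmxA DU !mulmx0.
Qed.

End Exactness.

Ltac in_span := solve [ auto 12 using in_cols_refl, in_cols_rowl, in_cols_rowr,
  in_cols_row, in_rows_refl, in_rows_colu, in_rows_cold, in_rows_col ].

Section InnerInverses.

(* [rp] and [lp] stand for [Rp] and [Lp]; being variables, they cannot be
   unfolded to differences by unification. *)
Variables (S : pzRingType) (ginv : forall m n, 'M[S]_(m, n) -> 'M[S]_(n, m)).
Variables (rp : forall m n, 'M[S]_(m, n) -> 'M[S]_m).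
Variables (lp : forall m n, 'M[S]_(m, n) -> 'M[S]_n).
Hypothesis ginvK : forall m n (A : 'M[S]_(m, n)), A *m ginv A *m A = A.
Hypothesis rpE : forall m n (A : 'M[S]_(m, n)), rp A = 1%:M - A *m ginv A.
Hypothesis lpE : forall m n (A : 'M[S]_(m, n)), lp A = 1%:M - ginv A *m A.

Lemma rp_mul m n (A : 'M[S]_(m, n)) : rp A *m A = 0.
Proof. by rewrite rpE mulmxBl mul1mx ginvK subrr. Qed.

Lemma mul_lp m n (A : 'M[S]_(m, n)) : A *m lp A = 0.
Proof. by rewrite lpE mulmxBr mulmx1 mulmxA ginvK subrr. Qed.

Lemma rp_eq0 m n p (A : 'M[S]_(m, n)) (X : 'M[S]_(m, p)) :
  rp A *m X = 0 -> A *m (ginv A *m X) = X.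
Proof. by rewrite rpE mulmxBl mul1mx mulmxA => /eqP; rewrite subr_eq0 => /eqP. Qed.

Lemma lp_eq0 m n p (D : 'M[S]_(m, n)) (X : 'M[S]_(p, n)) :
  X *m lp D = 0 -> X *m ginv D *m D = X.
Proof. by rewrite lpE mulmxBr mulmx1 mulmxA => /eqP; rewrite subr_eq0 => /eqP. Qed.

Lemma lp_mul_id m n p (D : 'M[S]_(m, n)) (X : 'M[S]_(n, p)) :
  D *m X = 0 -> lp D *m X = X.
Proof. by move=> DX; rewrite lpE mulmxBl mul1mx -mulmxA DX mulmx0 subr0. Qed.

Lemma mul_rp_id m n p (A : 'M[S]_(m, n)) (X : 'M[S]_(p, m)) :
  X *m A = 0 -> X *m rp A = X.
Proof. by move=> XA; rewrite rpE mulmxBr mulmx1 mulmxA XA mul0mx subr0. Qed.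

Lemma exact_rp m p (A : 'M[S]_(m, p)) : exact_at (rp A) A.
Proof.
move=> q X; split=> [/rp_eq0 <-|[W ->]]; first by exists (ginv A *m X).
by rewrite mulmxA rp_mul mul0mx.
Qed.

Lemma exact_lp k m (D : 'M[S]_(k, m)) : exact_at D (lp D).
Proof.
move=> q X; split=> [/lp_mul_id <-|[W ->]]; first by exists X.
by rewrite mulmxA mul_lp mul0mx.
Qed.

(** If L X = L B W, then X - B W lies in ker L = im A. Iterating this lemma identifies the kernels
    of all nested left projectors. *)
Lemma exact_row k m p p' (L : 'M[S]_(k, m)) (A : 'M[S]_(m, p))
    (B : 'M[S]_(m, p')) :
  exact_at L A -> exact_at (rp (L *m B) *m L) (row_mx B A).
Proof.
move=> LA q X; rewrite -mulmxA; split=> [/(exact_rp (L *m B) (L *m X))[W E]|[W ->]].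
  have [V XE] : in_cols (X - B *m W) A by apply/LA; rewrite mulmxBr E mulmxA subrr.
  by exists (col_mx W V); rewrite mul_row_col -XE subrKC.
rewrite -[W]vsubmxK mul_row_col mulmxDr !mulmxA (exact_mul0 LA) mul0mx addr0.
by rewrite (exact_rp (L *m B)); exists (usubmx W).
Qed.

Lemma exact_col k k' m p (D : 'M[S]_(k, m)) (D' : 'M[S]_(k', m))
    (U : 'M[S]_(m, p)) :
  exact_at D U -> exact_at (col_mx D' D) (U *m lp (D' *m U)).
Proof.
move=> DU q X; rewrite mul_col_mx -(col_mx0 S); split.
  move=> /eq_col_mx[D'X /DU[W XE]].
  have [V WE] : in_cols W (lp (D' *m U)).
    by apply/exact_lp; rewrite -mulmxA -XE.
  by exists V; rewrite XE WE mulmxA.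
move=> [V ->]; congr col_mx; first by rewrite !mulmxA mul_lp mul0mx.
by rewrite !mulmxA (exact_mul0 DU) !mul0mx.
Qed.

Lemma mulmx3_eq0_sum k m n l (C : 'M[S]_(k, m)) (D : 'M[S]_(n, l))
    (F : 'M[S]_(m, n)) :
  C *m F *m D = 0 -> exists X Y, F = lp C *m X + Y *m rp D.
Proof.
move=> CFD; exists F, (ginv C *m C *m F).
have E : ginv C *m C *m F *m D = 0 by rewrite -!mulmxA (mulmxA C) CFD mulmx0.
by rewrite mul_rp_id // -mulmxDl lpE subrK mul1mx.
Qed.

(** Z has to satisfy both M Z D = [rp A] E and C Z N = E [lp B]. [Z0] solves the first; adding J N^-
    repairs the second and keeps the first, since M J = 0. Then E - C Z D is killed by [rp A] on the
    left and by [lp B] on the right, hence of the form A Y B. *)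
Lemma two_term_solvable m n p q r s (A : 'M[S]_(m, p)) (B : 'M[S]_(q, n))
    (C : 'M[S]_(m, r)) (D : 'M[S]_(s, n)) (E : 'M[S]_(m, n)) :
  rp (rp A *m C) *m (rp A *m E) = 0 -> E *m lp B *m lp (D *m lp B) = 0 ->
  rp A *m E *m lp D = 0 -> rp C *m E *m lp B = 0 ->
  exists Y Z, A *m Y *m B + C *m Z *m D = E.
Proof.
move eM : (rp A *m C) => M; move eN : (D *m lp B) => N => ME EN AED CEB.
have [Z0 MZ0] : exists Z0, M *m Z0 *m D = rp A *m E.
  exists (ginv M *m (rp A *m E) *m ginv D).
  by rewrite mulmxA rp_eq0 // lp_eq0.
have [K KE] : exists K, K = (E - C *m Z0 *m D) *m lp B by eexists.
have AK : rp A *m K = 0.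
  by rewrite KE mulmxA (mulmxBr (rp A)) !mulmxA eM MZ0 subrr mul0mx.
have CK : rp C *m K = 0.
  by rewrite KE mulmxA (mulmxBr (rp C)) !mulmxA rp_mul !mul0mx subr0.
have KN : K *m lp N = 0.
  rewrite KE (mulmxBl _ _ (lp B)) -[X in _ - X]mulmxA eN (mulmxBl _ _ (lp N)).
  by rewrite EN -mulmxA mul_lp mulmx0 subrr.
have [J CJ JN] : exists2 J, C *m J = K & J *m ginv N *m N = J.
  exists (ginv C *m K); first exact: rp_eq0.
  by apply: lp_eq0; rewrite -mulmxA KN mulmx0.
have MJ : M *m J = 0 by rewrite -eM -mulmxA CJ.
have [Z ZE] : exists Z, Z = Z0 + J *m ginv N by eexists.
have AE : rp A *m (E - C *m Z *m D) = 0.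
  rewrite (mulmxBr (rp A)) !mulmxA eM ZE mulmxDr mulmxDl MZ0 !mulmxA MJ.
  by rewrite !mul0mx addr0 subrr.
have EB : (E - C *m Z *m D) *m lp B = 0.
  rewrite ZE mulmxDr mulmxDl opprD addrA (mulmxBl _ _ (lp B)) -KE -!mulmxA eN.
  by rewrite (mulmxA J) JN CJ subrr.
exists (ginv A *m (E - C *m Z *m D) *m ginv B), Z.
by rewrite mulmxA rp_eq0 // lp_eq0 // subrK.
Qed.

Lemma five_term_solvable m n p1 p2 p3 s1 s2 s3
    (A1 : 'M[S]_(m, p1)) (A2 : 'M[S]_(m, p2)) (A3 : 'M[S]_(m, p3))
    (B1 : 'M[S]_(s1, n)) (B2 : 'M[S]_(s2, n)) (B3 : 'M[S]_(s3, n))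
    (B : 'M[S]_(m, n)) A11 A22 B11 B22 T :
  A11 = rp A1 *m A2 -> A22 = rp A1 *m A3 ->
  B11 = B2 *m lp B1 -> B22 = B3 *m lp B1 -> T = rp A1 *m B *m lp B1 ->
  rp (rp A11 *m A22) *m rp A11 *m T = 0 ->
  T *m (lp B11 *m lp (B22 *m lp B11)) = 0 ->
  rp A11 *m T *m lp B22 = 0 -> rp A22 *m T *m lp B11 = 0 ->
  exists X1 X2 Y1 Y2,
    A1 *m X1 + X2 *m B1 + A2 *m Y1 *m B2 + A3 *m Y2 *m B3 = B.
Proof.
move=> A11E A22E B11E B22E TE h1 h2 h3 h4.
rewrite -mulmxA in h1; rewrite mulmxA in h2.
have [Y1 [Y2 YE]] := two_term_solvable h1 h2 h3 h4.
have [G eG] : exists G, G = B - (A2 *m Y1 *m B2 + A3 *m Y2 *m B3) by eexists.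
have GE : rp A1 *m G *m lp B1 = 0.
  rewrite eG (mulmxBr (rp A1)) (mulmxBl _ _ (lp B1)).
  apply/eqP; rewrite subr_eq0; apply/eqP; rewrite -TE -YE.
  rewrite (mulmxDr (rp A1)) (mulmxDl _ _ (lp B1)).
  by congr (_ + _); rewrite ?A11E ?A22E ?B11E ?B22E -!mulmxA.
(* The residue splits as G = A1 A1^- G + [rp A1] G, whose second part is a left multiple of [B1]
   since [lp B1] kills it on the right. *)
exists (ginv A1 *m G), (rp A1 *m G *m ginv B1), Y1, Y2.
by rewrite lp_eq0 // mulmxA -mulmxDl rpE subrKC mul1mx -addrA eG subrK.
Qed.

Lemma exact_sum k m p n l r (L : 'M[S]_(k, m)) (A : 'M[S]_(m, p))
    (D : 'M[S]_(l, n)) (U : 'M[S]_(n, r)) (E : 'M[S]_(m, n)) :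
  exact_at L A -> exact_at D U ->
  L *m E *m U = 0 -> exists X Y, E = A *m X + Y *m D.
Proof.
move=> LA DU /(exact_mulP E LA DU)/(exact_mulP E (@exact_rp _ _ A) (@exact_lp _ _ D)).
move=> AED; exists (ginv A *m E), (rp A *m E *m ginv D).
by rewrite lp_eq0 // mulmxA -mulmxDl rpE subrKC mul1mx.
Qed.

(** E1 Q = P E2 is forced on a common solution Y, both sides being C1 Y D2. In the second equation
    the two summands of F give C2 C1^- C1 C2^- E2 and C2 (1 - C1^- C1) C2^- E2, which add up to
    E2. *)
Lemma pair_solution p q k1 k2 l1 l2 (C1 : 'M[S]_(k1, p)) (C2 : 'M[S]_(k2, p))
    (D1 : 'M[S]_(q, l1)) (D2 : 'M[S]_(q, l2))
    (E1 : 'M[S]_(k1, l1)) (E2 : 'M[S]_(k2, l2)) P Q :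
  C1 = P *m C2 -> D2 = D1 *m Q -> E1 *m Q = P *m E2 ->
  rp C1 *m E1 = 0 -> E1 *m lp D1 = 0 -> rp C2 *m E2 = 0 -> E2 *m lp D2 = 0 ->
  let F := ginv C1 *m E1 *m ginv D1
           + lp C1 *m ginv C2 *m E2 *m ginv D2 in
  C1 *m F *m D1 = E1 /\ C2 *m F *m D2 = E2.
Proof.
move=> CP DQ EPQ CE1 ED1 CE2 ED2 F; split; rewrite /F.
  rewrite (mulmxDr C1) (mulmxDl _ _ D1) !mulmxA mul_lp !mul0mx addr0.
  by rewrite -(mulmxA C1) rp_eq0 // lp_eq0.
rewrite (mulmxDr C2) (mulmxDl _ _ D2).
have -> : C2 *m (ginv C1 *m E1 *m ginv D1) *m D2
          = C2 *m ginv C1 *m C1 *m ginv C2 *m E2.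
  rewrite {1}DQ -!mulmxA (mulmxA (ginv D1)) (mulmxA E1) (mulmxA E1) lp_eq0 //.
  by rewrite EPQ {3}CP -!mulmxA rp_eq0.
have -> : C2 *m (lp C1 *m ginv C2 *m E2 *m ginv D2) *m D2
          = C2 *m lp C1 *m ginv C2 *m E2.
  by rewrite -!mulmxA (mulmxA E2) lp_eq0.
rewrite -!mulmxA -mulmxDr (mulmxA _ C1) -mulmxDl lpE subrKC.
by rewrite mul1mx rp_eq0.
Qed.

(** C2 = P C4 gives ker C4 inside ker C2, so adjoining [lp C4] does not enlarge the column span of
    [lp C2]; likewise D3 = D1 Q puts the rows of [rp D1] in the row span of [rp D3]. *)
Lemma compatibility_condition p q k2 k3 k4 l1 l2 l3 (C2 : 'M[S]_(k2, p))
    (C3 : 'M[S]_(k3, p)) (C4 : 'M[S]_(k4, p)) (D1 : 'M[S]_(q, l1))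
    (D2 : 'M[S]_(q, l2)) (D3 : 'M[S]_(q, l3)) P Q (F : 'M[S]_(p, q)) :
  C2 = P *m C4 -> D3 = D1 *m Q ->
  let C11 := row_mx (lp C2) (lp C4) in
  let D11 := col_mx (rp D1) (rp D3) in
  let E22 := rp C11 *m lp C3 in
  let E33 := rp D2 *m lp D11 in
  rp E22 *m (rp C11 *m F *m lp D11) *m lp E33 = 0 <->
  rp (row_mx (lp C3) (lp C2)) *m F *m lp (col_mx (rp D2) (rp D3)) = 0.
Proof.
move=> CP DQ C11 D11 E22 E33.
have C42 : in_cols (lp C4) (lp C2).
  by apply/(@exact_lp _ _ C2); rewrite CP -mulmxA mul_lp mulmx0.
have D13 : in_rows (rp D1) (rp D3).
  by exists (rp D1); rewrite mul_rp_id // DQ mulmxA rp_mul mul0mx.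
have LA : exact_at (rp E22 *m rp C11) (row_mx (lp C3) (lp C2)).
  apply: exact_eq_cols (exact_row _ (@exact_rp _ _ C11)) _ _.
    apply: in_cols_row; first exact/in_cols_rowl/in_cols_refl.
    by apply/in_cols_rowr/in_cols_row => //; exact: in_cols_refl.
  apply: in_cols_row; first exact/in_cols_rowl/in_cols_refl.
  exact/in_cols_rowr/in_cols_rowl/in_cols_refl.
have DU : exact_at (col_mx (rp D2) (rp D3)) (lp D11 *m lp E33).
  apply: exact_eq_rows (exact_col _ (@exact_lp _ _ D11)) _ _.
    apply: in_rows_col; first exact/in_rows_colu/in_rows_refl.
    by apply/in_rows_cold/in_rows_col => //; exact: in_rows_refl.
  apply: in_rows_col; first exact/in_rows_colu/in_rows_refl.
  exact/in_rows_cold/in_rows_cold/in_rows_refl.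
have -> : rp E22 *m (rp C11 *m F *m lp D11) *m lp E33
  = (rp E22 *m rp C11) *m F *m (lp D11 *m lp E33) by rewrite !mulmxA.
by rewrite (exact_mulP F LA DU) (exact_mulP F (@exact_rp _ _ _) (@exact_lp _ _ _)).
Qed.

Lemma four_equations_solvable p q k1 k2 k3 k4 l1 l2 l3 l4
    (C1 : 'M[S]_(k1, p)) (C2 : 'M[S]_(k2, p))
    (C3 : 'M[S]_(k3, p)) (C4 : 'M[S]_(k4, p))
    (D1 : 'M[S]_(q, l1)) (D2 : 'M[S]_(q, l2))
    (D3 : 'M[S]_(q, l3)) (D4 : 'M[S]_(q, l4))
    (E1 : 'M[S]_(k1, l1)) (E2 : 'M[S]_(k2, l2))
    (E3 : 'M[S]_(k3, l3)) (E4 : 'M[S]_(k4, l4))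
    P2 P3 S2 S3 Q2 Q3 T2 T3 (F1 F2 : 'M[S]_(p, q)) :
  C1 = P2 *m C2 -> C1 = P3 *m C3 -> C2 = S2 *m C4 -> C3 = S3 *m C4 ->
  D2 = D1 *m Q2 -> D3 = D1 *m Q3 -> D4 = D2 *m T2 -> D4 = D3 *m T3 ->
  E1 *m Q3 = P3 *m E3 -> S2 *m E4 = E2 *m T2 ->
  C1 *m F1 *m D1 = E1 -> C2 *m F1 *m D2 = E2 ->
  C3 *m F2 *m D3 = E3 -> C4 *m F2 *m D4 = E4 ->
  (exists Y, [/\ C1 *m Y *m D1 = E1, C2 *m Y *m D2 = E2,
                 C3 *m Y *m D3 = E3 & C4 *m Y *m D4 = E4])
  <-> rp (row_mx (lp C3) (lp C2)) *m (F2 - F1) *m lp (col_mx (rp D2) (rp D3)) = 0.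
Proof.
move=> C12 C13 C24 C34 D12 D13 D24 D34 E13 E24 F1D1 F1D2 F2D3 F2D4.
have subE k l (C : 'M[S]_(k, p)) (D : 'M[S]_(q, l)) Y Z :
    C *m Y *m D = C *m Z *m D -> C *m (Y - Z) *m D = 0.
  by move=> YZ; rewrite mulmxBr (mulmxBl _ _ D) YZ subrr.
split=> [[Y [YE1 YE2 YE3 YE4]]|].
  have /mulmx3_eq0_sum[X2 [Z2 YF1]] : C2 *m (Y - F1) *m D2 = 0.
    by apply: subE; rewrite YE2.
  have /mulmx3_eq0_sum[X3 [Z3 YF2]] : C3 *m (F2 - Y) *m D3 = 0.
    by apply: subE; rewrite YE3.
  apply: (mul3_eq0 (rp_mul _) (mul_lp _) (X := col_mx X3 X2) (Y := row_mx Z2 Z3)).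
  rewrite !mul_row_col -(subrKA Y F2) YF1 YF2 addrACA.
  by congr (_ + _); exact: addrC.
move=> /(exact_sum (@exact_rp _ _ _) (@exact_lp _ _ _))[X [Y]].
move eF : (F2 - F1) => F FE.
(* These two identities make the remaining solvability conditions of the
   five-term equation for F hold automatically. *)
have C1FD3 : C1 *m F *m D3 = 0.
  rewrite -eF; apply: subE; rewrite {1}C13 -!mulmxA (mulmxA C3) F2D3 -E13 D13.
  by rewrite -F1D1 !mulmxA.
have C2FD4 : C2 *m F *m D4 = 0.
  rewrite -eF; apply: subE; rewrite {1}C24 -!mulmxA (mulmxA C4) F2D4 E24 D24.
  by rewrite -F1D2 !mulmxA.
have [X13 [Y13 FE13]] := mulmx3_eq0_sum C1FD3.
have [X24 [Y24 FE24]] := mulmx3_eq0_sum C2FD4.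
have [X1 [X2 [Y1 [Y2 YE]]]] : exists X1 X2 Y1 Y2,
    lp C2 *m X1 + X2 *m rp D3 + lp C1 *m Y1 *m rp D2 + lp C3 *m Y2 *m rp D4 = F.
  move ea : (lp C2) (rp D3) FE24 FE13 FE => a b FE24 FE13 FE.
  have [a2 a2E] : exists a2, a2 = rp a *m lp C1 by eexists.
  have [a3 a3E] : exists a3, a3 = rp a *m lp C3 by eexists.
  have [b2 b2E] : exists b2, b2 = rp D2 *m lp b by eexists.
  have [b3 b3E] : exists b3, b3 = rp D4 *m lp b by eexists.
  refine (five_term_solvable a2E a3E b2E b3E (erefl (rp a *m F *m lp b)) _ _ _ _).
  - have -> : rp (rp a2 *m a3) *m rp a2 *m (rp a *m F *m lp b)
      = (rp (rp a2 *m a3) *m rp a2 *m rp a) *m F *m lp b by rewrite !mulmxA.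
    apply: (mul3_eq0 _ _ FE13); last exact: mul_lp.
    by rewrite -!mulmxA -a2E (rp_mul a2) mulmx0.
  - have -> : (rp a *m F *m lp b) *m (lp b2 *m lp (b3 *m lp b2))
      = rp a *m F *m (lp b *m lp b2 *m lp (b3 *m lp b2)) by rewrite !mulmxA.
    apply: (mul3_eq0 _ _ FE24); first exact: rp_mul.
    by rewrite !mulmxA -b3E mul_lp.
  - have -> : rp a2 *m (rp a *m F *m lp b) *m lp b3
      = (rp a2 *m rp a) *m F *m (lp b *m lp b3) by rewrite !mulmxA.
    apply: (mul3_eq0 _ _ FE13); first by rewrite -mulmxA -a2E rp_mul.
    by rewrite mulmxA mul_lp mul0mx.
  - have -> : rp a3 *m (rp a *m F *m lp b) *m lp b2
      = (rp a3 *m rp a) *m F *m (lp b *m lp b2) by rewrite !mulmxA.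
    apply: (mul3_eq0 _ _ FE).
      by rewrite mul_mx_row -!mulmxA (rp_mul a) -a3E (rp_mul a3) mulmx0 row_mx0.
    by rewrite mul_col_mx !mulmxA (mul_lp b) -b2E (mul_lp b2) mul0mx col_mx0.
have [Y0 Y0E Y0F] : exists2 Y, Y - F1 = lp C2 *m X1 + lp C1 *m Y1 *m rp D2 &
    Y - F2 = - (X2 *m rp D3 + lp C3 *m Y2 *m rp D4).
  exists (F1 + (lp C2 *m X1 + lp C1 *m Y1 *m rp D2)); first by rewrite addrC addKr.
  have -> : F2 = F1 + F by rewrite -eF subrKC.
  rewrite -{}YE -(addrA (_ + X2 *m _)) [X in - (_ + X)]addrACA [X in - X]addrA.
  by rewrite opprD addrA subrr sub0r.
have addE k l (C : 'M[S]_(k, p)) (D : 'M[S]_(q, l)) Z :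
    C *m (Y0 - Z) *m D = 0 -> C *m Y0 *m D = C *m Z *m D.
  rewrite mulmxBr (mulmxBl _ _ D) => /eqP; rewrite subr_eq0; exact/eqP.
exists Y0; rewrite -F1D1 -F1D2 -F2D3 -F2D4; split; apply: addE.
- rewrite Y0E mulmxDr mulmxDl !mulmxA mul_lp !mul0mx addr0.
  by rewrite C12 -(mulmxA P2) mul_lp mulmx0 !mul0mx.
- rewrite Y0E mulmxDr mulmxDl !mulmxA mul_lp !mul0mx add0r.
  by rewrite -mulmxA rp_mul mulmx0.
- rewrite Y0F mulmxN mulNmx mulmxDr mulmxDl !mulmxA mul_lp !mul0mx addr0.
  by rewrite -mulmxA rp_mul mulmx0 oppr0.
- rewrite Y0F mulmxN mulNmx mulmxDr mulmxDl -!mulmxA rp_mul !mulmx0 addr0.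
  by rewrite D34 (mulmxA (rp D3)) rp_mul mul0mx !mulmx0 oppr0.
Qed.

Lemma exact_mul_rp_lp k m p n l r (L : 'M[S]_(k, m)) (A : 'M[S]_(m, p))
    (D : 'M[S]_(l, n)) (U : 'M[S]_(n, r)) (E : 'M[S]_(m, n)) :
  exact_at L A -> exact_at D U ->
  (L *m E *m U = 0 <-> rp A *m E *m lp D = 0).
Proof.
by move=> LA DU; rewrite (exact_mulP E LA DU)
  (exact_mulP E (@exact_rp _ _ A) (@exact_lp _ _ D)).
Qed.

(* On the left, Z ranges over im D_2 :&: im D_3, i.e. Z = B4 v = - B4 w with
   [v \in ker (B3; B1)] and [w \in ker (B2; B1)]; the common coefficient of A4 in
   the two rows on the right is F1 Z modulo ker C_2 and F2 Z modulo ker C_3. *)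
Lemma overlap_condition m n p1 p2 p3 p4 s1 s2 s3 s4 k2 k3 l2 l3
    (A1 : 'M[S]_(m, p1)) (A2 : 'M[S]_(m, p2))
    (A3 : 'M[S]_(m, p3)) (A4 : 'M[S]_(m, p4))
    (B1 : 'M[S]_(s1, n)) (B2 : 'M[S]_(s2, n))
    (B3 : 'M[S]_(s3, n)) (B4 : 'M[S]_(s4, n)) (B : 'M[S]_(m, n))
    (L2 : 'M[S]_(k2, m)) (L3 : 'M[S]_(k3, m))
    (U2 : 'M[S]_(n, l2)) (U3 : 'M[S]_(n, l3)) F1 F2 :
  exact_at L2 (row_mx A2 A1) -> exact_at L3 (row_mx A3 A1) ->
  exact_at (col_mx B3 B1) U2 -> exact_at (col_mx B2 B1) U3 ->
  (L2 *m A4) *m F1 *m (B4 *m U2) = L2 *m B *m U2 ->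
  (L3 *m A4) *m F2 *m (B4 *m U3) = L3 *m B *m U3 ->
  rp (row_mx (lp (L3 *m A4)) (lp (L2 *m A4))) *m (F2 - F1)
    *m lp (col_mx (rp (B4 *m U2)) (rp (B4 *m U3))) = 0 <->
  rp (col_mx (row_mx A2 (row_mx A1 (row_mx 0  (row_mx 0  A4))))
             (row_mx 0  (row_mx 0  (row_mx A3 (row_mx A1 A4)))))
    *m block_mx B 0 0 (- B)
    *m lp (col_mx (row_mx B3 0)
          (col_mx (row_mx B1 0)
          (col_mx (row_mx 0  B2)
          (col_mx (row_mx 0  B1)
                  (row_mx B4 B4))))) = 0.
Proof.
move=> L2A L3A U2B U3B F1E F2E.
move eC2 : (L2 *m A4) F1E => C2 F1E; move eC3 : (L3 *m A4) F2E => C3 F2E.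
move eD2 : (B4 *m U2) F1E => D2 F1E; move eD3 : (B4 *m U3) F2E => D3 F2E.
rewrite (exact_mulP _ (@exact_rp _ _ _) (@exact_lp _ _ _)).
rewrite (exact_mulP _ (@exact_rp _ _ _) (@exact_lp _ _ _)).
split=> [FZ q V|BV q Z].
  rewrite -[V]vsubmxK !mul_col_mx !mul_row_col !mul0mx ?addr0 ?add0r.
  move: (usubmx V) (dsubmx V) => v w /eqP; rewrite !col_mx_eq0.
  case/and5P=> /eqP B3v /eqP B1v /eqP B2w /eqP B1w /eqP B4vw.
  have [v' vE] : in_cols v U2 by apply/U2B; rewrite mul_col_mx B3v B1v col_mx0.
  have [w' wE] : in_cols w U3 by apply/U3B; rewrite mul_col_mx B2w B1w col_mx0.
  have ZD2 : B4 *m v = D2 *m v' by rewrite vE mulmxA eD2.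
  have ZD3 : B4 *m v = - (D3 *m w').
    by rewrite -eD3 -mulmxA -wE; apply/eqP; rewrite -addr_eq0 B4vw.
  have [X XE] : in_cols ((F2 - F1) *m (B4 *m v)) (row_mx (lp C3) (lp C2)).
    apply: FZ; rewrite mul_col_mx {1}ZD2 ZD3 mulmxN !mulmxA !rp_mul !mul0mx.
    by rewrite oppr0 col_mx0.
  (* The splitting of (F2 - F1) B4 v by [XE] makes this value equal to F2 B4 v corrected inside ker
     C3. *)
  have [x Dx] : exists x, F1 *m (B4 *m v) + lp C2 *m dsubmx X = x by eexists.
  have Dx' : F2 *m (B4 *m v) - lp C3 *m usubmx X = x.
    have -> : F2 *m (B4 *m v)
        = lp C3 *m usubmx X + lp C2 *m dsubmx X + F1 *m (B4 *m v).
      by apply/eqP; rewrite -subr_eq -mulmxBl XE -mul_row_col vsubmxK.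
    by rewrite -(addrA (lp C3 *m _)) [LHS]addrC addKr -Dx addrC.
  have [y yE] : in_cols (B *m v - A4 *m x) (row_mx A2 A1).
    apply/L2A; rewrite mulmxBr !mulmxA eC2 -Dx mulmxDr !mulmxA mul_lp mul0mx addr0.
    by rewrite -(mulmxA _ B4) ZD2 mulmxA F1E vE mulmxA subrr.
  have [z zE] : in_cols (- (B *m w) - A4 *m x) (row_mx A3 A1).
    apply/L3A; rewrite mulmxBr !mulmxA eC3 -Dx' mulmxBr !mulmxA mul_lp mul0mx subr0.
    by rewrite -(mulmxA _ B4) ZD3 !mulmxN !mulmxA F2E wE !mulmxA subrr.
  exists (col_mx (usubmx y) (col_mx (dsubmx y)
    (col_mx (usubmx z) (col_mx (dsubmx z) x)))).
  rewrite !mul_col_mx !mul_row_col !mul0mx !(addr0, add0r) mulNmx.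
  by congr col_mx; rewrite addrA -mul_row_col vsubmxK -?yE -?zE subrK.
rewrite mul_col_mx => /eqP; rewrite col_mx_eq0 => /andP[/eqP ZD2 /eqP ZD3].
have [v' vE] : in_cols Z D2 by apply/exact_rp.
have [w' wE] : in_cols Z D3 by apply/exact_rp.
(* The sign puts this vector in the kernel of the last block row, as B4 U2 v' and B4 U3 w' both
   equal Z. *)
have [|X XE] := BV _ (col_mx (U2 *m v') (- (U3 *m w'))).
  have := exact_mul0 U2B; rewrite mul_col_mx => /eqP.
  rewrite col_mx_eq0 => /andP[/eqP B3U /eqP B1U].
  have := exact_mul0 U3B; rewrite mul_col_mx => /eqP.
  rewrite col_mx_eq0 => /andP[/eqP B2U /eqP B1U'].
  rewrite !mul_col_mx !mul_row_col !mul0mx !mulmxN !mulmxA B3U B1U B2U B1U'.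
  by rewrite eD2 eD3 -vE -wE subrr !mul0mx !oppr0 !addr0 !col_mx0.
move: XE; rewrite mul_block_col -[X]vsubmxK -[dsubmx X]vsubmxK.
rewrite -[dsubmx (dsubmx X)]vsubmxK -[dsubmx (dsubmx (dsubmx X))]vsubmxK.
move: (usubmx X) (usubmx (dsubmx X)) (usubmx (dsubmx (dsubmx X)))
  (usubmx (dsubmx (dsubmx (dsubmx X)))) (dsubmx (dsubmx (dsubmx (dsubmx X)))).
move=> x2 x1 x3 x1' x.
rewrite !mul_col_mx !mul_row_col !mul0mx !(addr0, add0r) mulNmx mulmxN opprK.
case/eq_col_mx => BvE BwE.
have Z2 : C2 *m (F1 *m Z - x) = 0.
  rewrite mulmxBr {1}vE !mulmxA F1E -!mulmxA BvE addrA -mul_row_col mulmxDr.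
  by rewrite mulmxA (exact_mul0 L2A) mul0mx add0r mulmxA eC2 subrr.
have Z3 : C3 *m (F2 *m Z - x) = 0.
  rewrite mulmxBr {1}wE !mulmxA F2E -!mulmxA BwE addrA -mul_row_col mulmxDr.
  by rewrite mulmxA (exact_mul0 L3A) mul0mx add0r mulmxA eC3 subrr.
exists (col_mx (F2 *m Z - x) (- (F1 *m Z - x))).
by rewrite mul_row_col mulmxN !lp_mul_id // mulmxBl opprB addrA subrK.
Qed.

(** * The original equation and its reduced system *)

Section FiveTermSystem.

Variables (m n p1 p2 p3 p4 s1 s2 s3 s4 : nat).
Variables (A1 : 'M[S]_(m, p1)) (A2 : 'M[S]_(m, p2)).
Variables (A3 : 'M[S]_(m, p3)) (A4 : 'M[S]_(m, p4)).
Variables (B1 : 'M[S]_(s1, n)) (B2 : 'M[S]_(s2, n)).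
Variables (B3 : 'M[S]_(s3, n)) (B4 : 'M[S]_(s4, n)) (B : 'M[S]_(m, n)).
Variables (A11 : 'M[S]_(m, p2)) (A22 : 'M[S]_(m, p3)) (A33 : 'M[S]_(m, p4)).
Variables (B11 : 'M[S]_(s2, n)) (B22 : 'M[S]_(s3, n)) (B33 : 'M[S]_(s4, n)).
Variables (N1 : 'M[S]_(s3, n)) (M1 : 'M[S]_(m, p3)) (T1 : 'M[S]_(m, n)).
Variables (C : 'M[S]_m) (C1 C2 C3 : 'M[S]_(m, p4)).
Variables (D : 'M[S]_n) (D2 D3 D4 : 'M[S]_(s4, n)).
Variables (E1 E2 E3 E4 : 'M[S]_(m, n)).

Hypotheses (A11E : A11 = rp A1 *m A2) (A22E : A22 = rp A1 *m A3).
Hypothesis (A33E : A33 = rp A1 *m A4).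
Hypotheses (B11E : B11 = B2 *m lp B1) (B22E : B22 = B3 *m lp B1).
Hypothesis (B33E : B33 = B4 *m lp B1).
Hypotheses (N1E : N1 = B22 *m lp B11) (M1E : M1 = rp A11 *m A22).
Hypothesis (T1E : T1 = rp A1 *m B *m lp B1).
Hypotheses (CE : C = rp M1 *m rp A11) (C1E : C1 = C *m A33).
Hypotheses (C2E : C2 = rp A11 *m A33) (C3E : C3 = rp A22 *m A33).
Hypotheses (DE : D = lp B11 *m lp N1) (D2E : D2 = B33 *m lp B22).
Hypotheses (D3E : D3 = B33 *m lp B11) (D4E : D4 = B33 *m D).
Hypotheses (E1E : E1 = C *m T1) (E2E : E2 = rp A11 *m T1 *m lp B22).
Hypotheses (E3E : E3 = rp A22 *m T1 *m lp B11) (E4E : E4 = T1 *m D).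

Let F1 := ginv C1 *m E1 *m ginv B33 + lp C1 *m ginv C2 *m E2 *m ginv D2.
Let F2 := ginv C3 *m E3 *m ginv D3 + lp C3 *m ginv A33 *m E4 *m ginv D4.
Let C11 := row_mx (lp C2) (lp A33).
Let D11 := col_mx (rp B33) (rp D3).
Let E22 := rp C11 *m lp C3.
Let E33 := rp D2 *m lp D11.
Let E := rp C11 *m (F2 - F1) *m lp D11.

(** [C] eliminates A2 first and A3 second; this restores the symmetry, giving C1 = C C3 besides C1 =
    [rp M1] C2. *)
Lemma C_rp_A22 : C *m rp A22 = C.
Proof. by apply: mul_rp_id; rewrite CE -mulmxA -M1E rp_mul. Qed.

Lemma lp_B22_D : lp B22 *m D = D.
Proof. by apply: lp_mul_id; rewrite DE mulmxA -N1E mul_lp. Qed.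

(** [A33] plays the role of C_4 and [B33] that of D_1. *)
Definition range_conditions :=
  (rp C1 *m E1 = 0 /\ E1 *m lp B33 = 0) /\
  (rp C2 *m E2 = 0 /\ E2 *m lp D2 = 0) /\
  (rp C3 *m E3 = 0 /\ E3 *m lp D3 = 0) /\
  (rp A33 *m E4 = 0 /\ E4 *m lp D4 = 0).

(** [pair_solution] applies with P = [rp M1], Q = [lp B22] to equations 1, 2, and with P = [rp A22],
    Q = [lp N1] to 3, 4. *)
Lemma particular_solutions : range_conditions ->
  [/\ C1 *m F1 *m B33 = E1, C2 *m F1 *m D2 = E2,
      C3 *m F2 *m D3 = E3 & A33 *m F2 *m D4 = E4].
Proof.
case=> -[h1 h1'] [[h2 h2'] [[h3 h3'] [h4 h4']]].
have C12 : C1 = rp M1 *m C2 by rewrite C1E CE C2E mulmxA.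
have E12 : E1 *m lp B22 = rp M1 *m E2 by rewrite E1E CE E2E !mulmxA.
have [-> ->] := pair_solution C12 D2E E12 h1 h1' h2 h2'.
have D34 : D4 = D3 *m lp N1 by rewrite D4E D3E DE mulmxA.
have E34 : E3 *m lp N1 = rp A22 *m E4 by rewrite E3E E4E DE !mulmxA.
by have [-> ->] := pair_solution C3E D34 E34 h3 h3' h4 h4'.
Qed.

Lemma reduced_system_solvable : range_conditions ->
  (exists Y, [/\ C1 *m Y *m B33 = E1, C2 *m Y *m D2 = E2,
                 C3 *m Y *m D3 = E3 & A33 *m Y *m D4 = E4])
  <-> rp (row_mx (lp C3) (lp C2)) *m (F2 - F1) *m lp (col_mx (rp D2) (rp D3)) = 0.
Proof.
move/particular_solutions => [F1E1 F1E2 F2E3 F2E4].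
have C12 : C1 = rp M1 *m C2 by rewrite C1E CE C2E mulmxA.
have C13 : C1 = C *m C3 by rewrite C3E mulmxA C_rp_A22.
have D24 : D4 = D2 *m D by rewrite D4E D2E -mulmxA lp_B22_D.
have D34 : D4 = D3 *m lp N1 by rewrite D4E D3E DE mulmxA.
have E13 : E1 *m lp B11 = C *m E3 by rewrite E1E E3E !mulmxA C_rp_A22.
have E24 : rp A11 *m E4 = E2 *m D by rewrite E2E E4E -!mulmxA lp_B22_D.
exact: (four_equations_solvable C12 C13 C2E C3E D2E D3E D24 D34 E13 E24).
Qed.

Lemma consistent_reduced :
  (exists X1 X2 Y1 Y2 Y3, A1 *m X1 + X2 *m B1 + A2 *m Y1 *m B2
     + A3 *m Y2 *m B3 + A4 *m Y3 *m B4 = B) <->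
  (exists Y, [/\ C1 *m Y *m B33 = E1, C2 *m Y *m D2 = E2,
                 C3 *m Y *m D3 = E3 & A33 *m Y *m D4 = E4]).
Proof.
split=> [[X1 [X2 [Y1 [Y2 [Y3 BE]]]]]|[Y [YE1 YE2 YE3 YE4]]].
  exists Y3.
  have T1Y : T1 = A11 *m Y1 *m B11 + A22 *m Y2 *m B22 + A33 *m Y3 *m B33.
    rewrite T1E -BE !(mulmxDr (rp A1)) !(mulmxDl _ _ (lp B1)) !mulmxA rp_mul.
    rewrite !mul0mx add0r -(mulmxA _ B1) mul_lp mulmx0 add0r.
    by rewrite A11E A22E A33E B11E B22E B33E !mulmxA.
  have CA11 : C *m A11 = 0 by rewrite CE -mulmxA rp_mul mulmx0.
  have CA22 : C *m A22 = 0 by rewrite CE -mulmxA -M1E rp_mul.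
  have B11D : B11 *m D = 0 by rewrite DE mulmxA mul_lp mul0mx.
  have B22D : B22 *m D = 0 by rewrite DE mulmxA -N1E mul_lp.
  split.
  - by rewrite E1E T1Y !mulmxDr !mulmxA CA11 CA22 !mul0mx !add0r C1E.
  - rewrite E2E T1Y !mulmxDr !mulmxDl !mulmxA rp_mul !mul0mx add0r.
    by rewrite -(mulmxA _ B22) mul_lp mulmx0 add0r C2E D2E !mulmxA.
  - rewrite E3E T1Y !mulmxDr !mulmxDl !mulmxA rp_mul !mul0mx addr0.
    by rewrite -(mulmxA _ B11) mul_lp mulmx0 add0r C3E D3E !mulmxA.
  - rewrite E4E T1Y !mulmxDl -!(mulmxA _ _ D) B11D B22D !mulmx0 !add0r.
    by rewrite D4E !mulmxA.
(* With A4 Y B4 moved to the right-hand side, the four solvability conditions are the four equations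
   for Y. *)
have TY : rp A1 *m (B - A4 *m Y *m B4) *m lp B1 = T1 - A33 *m Y *m B33.
  by rewrite mulmxBr mulmxBl -T1E A33E B33E !mulmxA.
have [||||X1 [X2 [Y1 [Y2 BE]]]] :=
    five_term_solvable A11E A22E B11E B22E (esym TY).
- by rewrite -M1E -CE mulmxBr !mulmxA -C1E YE1 E1E subrr.
- by rewrite -N1E -DE mulmxBl -(mulmxA _ B33) -D4E YE4 E4E subrr.
- rewrite mulmxBr mulmxBl !mulmxA -C2E -(mulmxA _ B33) -D2E YE2 E2E.
  exact: subrr.
- rewrite mulmxBr mulmxBl !mulmxA -C3E -(mulmxA _ B33) -D3E YE3 E3E.
  exact: subrr.
by exists X1, X2, Y1, Y2, Y; rewrite BE subrK.
Qed.

Lemma compatibility_E :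
  rp E22 *m E *m lp E33 = 0 <->
  rp (row_mx (lp C3) (lp C2)) *m (F2 - F1) *m lp (col_mx (rp D2) (rp D3)) = 0.
Proof. exact: (compatibility_condition C3 D2 (F2 - F1) C2E D3E). Qed.

Lemma range_conditions_of_solution Y :
  [/\ C1 *m Y *m B33 = E1, C2 *m Y *m D2 = E2,
      C3 *m Y *m D3 = E3 & A33 *m Y *m D4 = E4] -> range_conditions.
Proof.
have solved k l (K : 'M[S]_(k, p4)) (L : 'M[S]_(s4, l)) Z :
    K *m Y *m L = Z -> rp K *m Z = 0 /\ Z *m lp L = 0.
  by move=> <-; rewrite !mulmxA rp_mul !mul0mx -mulmxA mul_lp mulmx0.
by case=> /solved ? /solved ? /solved ? /solved ?.
Qed.

Lemma range_conditions_blocks :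
  range_conditions <->
  rp (row_mx A2 (row_mx A3 (row_mx A4 A1))) *m B *m lp B1 = 0 /\
  rp (row_mx A2 (row_mx A4 A1)) *m B *m lp (col_mx B3 B1) = 0 /\
  rp (row_mx A3 (row_mx A4 A1)) *m B *m lp (col_mx B2 B1) = 0 /\
  rp (row_mx A4 A1) *m B *m lp (col_mx B2 (col_mx B3 B1)) = 0 /\
  rp (row_mx A2 (row_mx A3 A1)) *m B *m lp (col_mx B4 B1) = 0 /\
  rp (row_mx A2 A1) *m B *m lp (col_mx B3 (col_mx B4 B1)) = 0 /\
  rp (row_mx A3 A1) *m B *m lp (col_mx B2 (col_mx B4 B1)) = 0 /\
  rp A1 *m B *m lp (col_mx B2 (col_mx B3 (col_mx B4 B1))) = 0.
Proof.
have cols_eq k a b (L : 'M[S]_(k, m)) (M : 'M[S]_(m, a)) (M' : 'M[S]_(m, b)) :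
    exact_at L M -> in_cols M M' /\ in_cols M' M -> exact_at L M'.
  by move=> LM [MM' M'M]; exact: exact_eq_cols LM MM' M'M.
have rows_eq k a b (U : 'M[S]_(n, k)) (M : 'M[S]_(a, n)) (M' : 'M[S]_(b, n)) :
    exact_at M U -> in_rows M M' /\ in_rows M' M -> exact_at M' U.
  by move=> MU [MM' M'M]; exact: exact_eq_rows MU MM' M'M.
(* The digits in [xA421], [xB421] and the like list the stacked blocks; what remains afterwards is
   to match the order of the blocks. *)
have xA1 := @exact_rp _ _ A1; have xB1 := @exact_lp _ _ B1.
have xA21 := exact_row A2 xA1; rewrite -A11E in xA21.
have xA31 := exact_row A3 xA1; rewrite -A22E in xA31.
have xA41 := exact_row A4 xA1; rewrite -A33E in xA41.
have xA321 := exact_row A3 xA21.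
rewrite -(mulmxA _ _ A3) -A22E -M1E mulmxA -CE in xA321.
have xA421 := exact_row A4 xA21; rewrite -(mulmxA _ _ A4) -A33E -C2E in xA421.
have xA431 := exact_row A4 xA31; rewrite -(mulmxA _ _ A4) -A33E -C3E in xA431.
have xA4321 := exact_row A4 xA321; rewrite -(mulmxA _ _ A4) -A33E -C1E in xA4321.
have xB21 := exact_col B2 xB1; rewrite -B11E in xB21.
have xB31 := exact_col B3 xB1; rewrite -B22E in xB31.
have xB41 := exact_col B4 xB1; rewrite -B33E in xB41.
have xB321 := exact_col B3 xB21.
rewrite (mulmxA B3) -B22E -N1E -mulmxA -DE in xB321.
have xB421 := exact_col B4 xB21; rewrite (mulmxA B4) -B33E -D3E in xB421.
have xB431 := exact_col B4 xB31; rewrite (mulmxA B4) -B33E -D2E in xB431.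
have xB4321 := exact_col B4 xB321; rewrite (mulmxA B4) -B33E -D4E in xB4321.
have q1 : rp C1 *m E1 = 0 <->
    rp (row_mx A2 (row_mx A3 (row_mx A4 A1))) *m B *m lp B1 = 0.
  have -> : rp C1 *m E1 = (rp C1 *m (C *m rp A1)) *m B *m lp B1.
    by rewrite E1E T1E !mulmxA.
  apply: exact_mul_rp_lp xB1; apply: cols_eq xA4321 _; split; in_span.
have q2 : rp C2 *m E2 = 0 <->
    rp (row_mx A2 (row_mx A4 A1)) *m B *m lp (col_mx B3 B1) = 0.
  have -> : rp C2 *m E2
      = (rp C2 *m (rp A11 *m rp A1)) *m B *m (lp B1 *m lp B22).
    by rewrite E2E T1E !mulmxA.
  apply: exact_mul_rp_lp xB31; apply: cols_eq xA421 _; split; in_span.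
have q3 : rp C3 *m E3 = 0 <->
    rp (row_mx A3 (row_mx A4 A1)) *m B *m lp (col_mx B2 B1) = 0.
  have -> : rp C3 *m E3
      = (rp C3 *m (rp A22 *m rp A1)) *m B *m (lp B1 *m lp B11).
    by rewrite E3E T1E !mulmxA.
  apply: exact_mul_rp_lp xB21; apply: cols_eq xA431 _; split; in_span.
have q4 : rp A33 *m E4 = 0 <->
    rp (row_mx A4 A1) *m B *m lp (col_mx B2 (col_mx B3 B1)) = 0.
  have -> : rp A33 *m E4 = (rp A33 *m rp A1) *m B *m (lp B1 *m D).
    by rewrite E4E T1E !mulmxA.
  apply: exact_mul_rp_lp xA41 _; apply: rows_eq xB321 _; split; in_span.
have q5 : E1 *m lp B33 = 0 <->
    rp (row_mx A2 (row_mx A3 A1)) *m B *m lp (col_mx B4 B1) = 0.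
  have -> : E1 *m lp B33 = (C *m rp A1) *m B *m (lp B1 *m lp B33).
    by rewrite E1E T1E !mulmxA.
  apply: exact_mul_rp_lp xB41; apply: cols_eq xA321 _; split; in_span.
have q6 : E2 *m lp D2 = 0 <->
    rp (row_mx A2 A1) *m B *m lp (col_mx B3 (col_mx B4 B1)) = 0.
  have -> : E2 *m lp D2
      = (rp A11 *m rp A1) *m B *m (lp B1 *m lp B22 *m lp D2).
    by rewrite E2E T1E !mulmxA.
  apply: exact_mul_rp_lp xA21 _; apply: rows_eq xB431 _; split; in_span.
have q7 : E3 *m lp D3 = 0 <->
    rp (row_mx A3 A1) *m B *m lp (col_mx B2 (col_mx B4 B1)) = 0.
  have -> : E3 *m lp D3
      = (rp A22 *m rp A1) *m B *m (lp B1 *m lp B11 *m lp D3).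
    by rewrite E3E T1E !mulmxA.
  apply: exact_mul_rp_lp xA31 _; apply: rows_eq xB421 _; split; in_span.
have q8 : E4 *m lp D4 = 0 <->
    rp A1 *m B *m lp (col_mx B2 (col_mx B3 (col_mx B4 B1))) = 0.
  have -> : E4 *m lp D4 = rp A1 *m B *m (lp B1 *m D *m lp D4).
    by rewrite E4E T1E !mulmxA.
  apply: exact_mul_rp_lp xA1 _; apply: rows_eq xB4321 _; split; in_span.
by rewrite /range_conditions -q1 -q2 -q3 -q4 -q5 -q6 -q7 -q8; tauto.
Qed.

Lemma compatibility_block : range_conditions ->
  rp E22 *m E *m lp E33 = 0 <->
  rp (col_mx (row_mx A2 (row_mx A1 (row_mx 0  (row_mx 0  A4))))
             (row_mx 0  (row_mx 0  (row_mx A3 (row_mx A1 A4)))))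
    *m block_mx B 0 0 (- B)
    *m lp (col_mx (row_mx B3 0)
          (col_mx (row_mx B1 0)
          (col_mx (row_mx 0  B2)
          (col_mx (row_mx 0  B1)
                  (row_mx B4 B4))))) = 0.
Proof.
move/particular_solutions => [_ F1E2 F2E3 _]; rewrite compatibility_E.
have C2A4 : C2 = (rp A11 *m rp A1) *m A4 by rewrite C2E A33E mulmxA.
have C3A4 : C3 = (rp A22 *m rp A1) *m A4 by rewrite C3E A33E mulmxA.
have D2B4 : D2 = B4 *m (lp B1 *m lp B22) by rewrite D2E B33E mulmxA.
have D3B4 : D3 = B4 *m (lp B1 *m lp B11) by rewrite D3E B33E mulmxA.
have xA1 := @exact_rp _ _ A1; have xB1 := @exact_lp _ _ B1.
rewrite {1}C2A4 {1}C3A4 {1}D2B4 {1}D3B4; apply: overlap_condition.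
- by rewrite A11E; exact: exact_row.
- by rewrite A22E; exact: exact_row.
- by rewrite B22E; exact: exact_col.
- by rewrite B11E; exact: exact_col.
- by rewrite -C2A4 -D2B4 F1E2 E2E T1E !mulmxA.
- by rewrite -C3A4 -D3B4 F2E3 E3E T1E !mulmxA.
Qed.

Lemma consistentP :
  (exists X1 X2 Y1 Y2 Y3, A1 *m X1 + X2 *m B1 + A2 *m Y1 *m B2
     + A3 *m Y2 *m B3 + A4 *m Y3 *m B4 = B) <->
  range_conditions /\ rp E22 *m E *m lp E33 = 0.
Proof.
rewrite consistent_reduced compatibility_E; split=> [[Y YE]|[rc]].
  have rc := range_conditions_of_solution YE.
  by split=> //; apply/(reduced_system_solvable rc); exists Y.
by move/(reduced_system_solvable rc).
Qed.

End FiveTermSystem.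
End InnerInverses.

(** * Rank conditions *)

Section RankUnderBlockOperations.

Variable R : realType.

Local Notation H := (quat R).

Lemma qrank_eq_rows n p p' (A : 'M[H]_(p, n)) (A' : 'M[H]_(p', n)) :
  in_rows A A' -> in_rows A' A -> qrank A = qrank A'.
Proof.
have le q q' (X : 'M[H]_(q, n)) (Y : 'M[H]_(q', n)) :
    in_rows X Y -> (qrank X <= qrank Y)%N.
  by case=> W ->; have := qrank_mulmx_le W Y 1%:M; rewrite mulmx1.
by move=> ? ?; apply/eqP; rewrite eqn_leq !le.
Qed.

Lemma qrank_eq_cols m p p' (A : 'M[H]_(m, p)) (A' : 'M[H]_(m, p')) :
  in_cols A A' -> in_cols A' A -> qrank A = qrank A'.
Proof.
have le q q' (X : 'M[H]_(m, q)) (Y : 'M[H]_(m, q')) :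
    in_cols X Y -> (qrank X <= qrank Y)%N.
  by case=> W ->; have := qrank_mulmx_le 1%:M Y W; rewrite mul1mx.
by move=> ? ?; apply/eqP; rewrite eqn_leq !le.
Qed.

Lemma row_mx_col_mx m1 m2 n1 n2 (A : 'M[H]_(m1, n1)) (B : 'M[H]_(m2, n1))
    (A' : 'M[H]_(m1, n2)) (B' : 'M[H]_(m2, n2)) :
  row_mx (col_mx A B) (col_mx A' B') = col_mx (row_mx A A') (row_mx B B').
Proof. by rewrite -block_mxEh block_mxEv. Qed.

Lemma row_mx_col_mx0 m1 m2 n1 n2 (A : 'M[H]_(m1, n1)) (B : 'M[H]_(m2, n1)) :
  row_mx (col_mx A B) 0
  = col_mx (row_mx A (0 : 'M[H]_(m1, n2))) (row_mx B (0 : 'M[H]_(m2, n2))).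
Proof. by rewrite -row_mx_col_mx col_mx0. Qed.

(** [W] and [W'] are fixed before the blocks, so one column permutation acts on all block rows of
    the large matrix at once. *)
Lemma column_shuffle n p q r :
  exists W W', forall k (b b' : 'M[H]_(k, n)) (a : 'M[H]_(k, p))
      (c : 'M[H]_(k, q)) (d : 'M[H]_(k, r)),
    row_mx (row_mx b b') (row_mx a (row_mx c d)) *m W
      = row_mx b (row_mx a (row_mx c (row_mx b' d))) /\
    row_mx b (row_mx a (row_mx c (row_mx b' d))) *m W'
      = row_mx (row_mx b b') (row_mx a (row_mx c d)).
Proof.
exists (col_mx (col_mx (row_mx 1%:M (row_mx 0 (row_mx 0 (row_mx 0 0))))
                       (row_mx 0 (row_mx 0 (row_mx 0 (row_mx 1%:M 0)))))
       (col_mx (row_mx 0 (row_mx 1%:M (row_mx 0 (row_mx 0 0))))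
       (col_mx (row_mx 0 (row_mx 0 (row_mx 1%:M (row_mx 0 0))))
               (row_mx 0 (row_mx 0 (row_mx 0 (row_mx 0 1%:M))))))).
exists (col_mx (row_mx (row_mx 1%:M 0) (row_mx 0 (row_mx 0 0)))
       (col_mx (row_mx (row_mx 0 0) (row_mx 1%:M (row_mx 0 0)))
       (col_mx (row_mx (row_mx 0 0) (row_mx 0 (row_mx 1%:M 0)))
       (col_mx (row_mx (row_mx 0 1%:M) (row_mx 0 (row_mx 0 0)))
               (row_mx (row_mx 0 0) (row_mx 0 (row_mx 0 1%:M))))))).
by move=> k b b' a c d; split; rewrite !mul_row_col !mul_mx_row !mulmx0 !mulmx1
  !add_row_mx !(addr0, add0r).
Qed.

Lemma qrank_interleave m n p1 p2 p3 p4 s1 s2 s3 s4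
    (A1 : 'M[H]_(m, p1)) (A2 : 'M[H]_(m, p2))
    (A3 : 'M[H]_(m, p3)) (A4 : 'M[H]_(m, p4))
    (B1 : 'M[H]_(s1, n)) (B2 : 'M[H]_(s2, n))
    (B3 : 'M[H]_(s3, n)) (B4 : 'M[H]_(s4, n)) (B : 'M[H]_(m, n)) :
  qrank
    (col_mx (row_mx B  (row_mx A2 (row_mx A1 (row_mx 0     (row_mx 0  (row_mx 0  A4))))))
    (col_mx (row_mx B3 (row_mx 0  (row_mx 0  (row_mx 0     (row_mx 0  (row_mx 0  0))))))
    (col_mx (row_mx B1 (row_mx 0  (row_mx 0  (row_mx 0     (row_mx 0  (row_mx 0  0))))))
    (col_mx (row_mx 0  (row_mx 0  (row_mx 0  (row_mx (- B) (row_mx A3 (row_mx A1 A4))))))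
    (col_mx (row_mx 0  (row_mx 0  (row_mx 0  (row_mx B2    (row_mx 0  (row_mx 0  0))))))
    (col_mx (row_mx 0  (row_mx 0  (row_mx 0  (row_mx B1    (row_mx 0  (row_mx 0  0))))))
            (row_mx B4 (row_mx 0  (row_mx 0  (row_mx B4    (row_mx 0  (row_mx 0  0))))))))))))
  = qrank (block_mx (block_mx B 0 0 (- B))
      (col_mx (row_mx A2 (row_mx A1 (row_mx 0  (row_mx 0  A4))))
              (row_mx 0  (row_mx 0  (row_mx A3 (row_mx A1 A4)))))
      (col_mx (row_mx B3 0)
      (col_mx (row_mx B1 0)
      (col_mx (row_mx 0  B2)
      (col_mx (row_mx 0  B1)
              (row_mx B4 B4))))) 0).
Proof.
have -> : block_mx (block_mx B 0 0 (- B))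
      (col_mx (row_mx A2 (row_mx A1 (row_mx 0  (row_mx 0  A4))))
              (row_mx 0  (row_mx 0  (row_mx A3 (row_mx A1 A4)))))
      (col_mx (row_mx B3 0)
      (col_mx (row_mx B1 0)
      (col_mx (row_mx 0  B2)
      (col_mx (row_mx 0  B1)
              (row_mx B4 B4))))) 0
  = col_mx (col_mx
    (row_mx (row_mx B 0) (row_mx A2 (row_mx A1 (row_mx 0 (row_mx 0 A4)))))
    (row_mx (row_mx 0 (- B)) (row_mx 0 (row_mx 0 (row_mx A3 (row_mx A1 A4))))))
   (col_mx (row_mx (row_mx B3 0) (row_mx 0 (row_mx 0 (row_mx 0 (row_mx 0 0)))))
   (col_mx (row_mx (row_mx B1 0) (row_mx 0 (row_mx 0 (row_mx 0 (row_mx 0 0)))))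
   (col_mx (row_mx (row_mx 0 B2) (row_mx 0 (row_mx 0 (row_mx 0 (row_mx 0 0)))))
   (col_mx (row_mx (row_mx 0 B1) (row_mx 0 (row_mx 0 (row_mx 0 (row_mx 0 0)))))
           (row_mx (row_mx B4 B4) (row_mx 0 (row_mx 0 (row_mx 0 (row_mx 0 0))))))))).
  by rewrite block_mxEv [block_mx B _ _ _]block_mxEv row_mx_col_mx
    !row_mx_col_mx0 !row_mx0.
have [W [W' WE]] := column_shuffle n p2 p1 (p3 + (p1 + p4)).
set M := RHS; have -> : M = qrank (col_mx
    (row_mx (row_mx B 0) (row_mx A2 (row_mx A1 (row_mx 0 (row_mx 0 A4)))))
   (col_mx (row_mx (row_mx B3 0) (row_mx 0 (row_mx 0 (row_mx 0 (row_mx 0 0)))))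
   (col_mx (row_mx (row_mx B1 0) (row_mx 0 (row_mx 0 (row_mx 0 (row_mx 0 0)))))
   (col_mx
    (row_mx (row_mx 0 (- B)) (row_mx 0 (row_mx 0 (row_mx A3 (row_mx A1 A4)))))
   (col_mx (row_mx (row_mx 0 B2) (row_mx 0 (row_mx 0 (row_mx 0 (row_mx 0 0)))))
   (col_mx (row_mx (row_mx 0 B1) (row_mx 0 (row_mx 0 (row_mx 0 (row_mx 0 0)))))
     (row_mx (row_mx B4 B4) (row_mx 0 (row_mx 0 (row_mx 0 (row_mx 0 0))))))))))).
  by rewrite /M; apply: qrank_eq_rows; in_span.
apply: qrank_eq_cols; [exists W|exists W'].
  by rewrite !mul_col_mx !(WE _ _ _ _ _ _).1.
by rewrite !mul_col_mx !(WE _ _ _ _ _ _).2.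
Qed.

End RankUnderBlockOperations.

Theorem theorem3p2 (R : realType) (m n p1 p2 p3 p4 s1 s2 s3 s4 : nat)
    (A1 : 'M[quat R]_(m, p1)) (A2 : 'M[quat R]_(m, p2))
    (A3 : 'M[quat R]_(m, p3)) (A4 : 'M[quat R]_(m, p4))
    (B1 : 'M[quat R]_(s1, n)) (B2 : 'M[quat R]_(s2, n))
    (B3 : 'M[quat R]_(s3, n)) (B4 : 'M[quat R]_(s4, n))
    (B : 'M[quat R]_(m, n)) :
  let A11 := Rp A1 *m A2 in
  let A22 := Rp A1 *m A3 in
  let A33 := Rp A1 *m A4 in
  let B11 := B2 *m Lp B1 in
  let B22 := B3 *m Lp B1 in
  let B33 := B4 *m Lp B1 in
  let N1 := B22 *m Lp B11 in
  let M1 := Rp A11 *m A22 in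
  let T1 := Rp A1 *m B *m Lp B1 in
  let C := Rp M1 *m Rp A11 in
  let C1 := C *m A33 in
  let C2 := Rp A11 *m A33 in
  let C3 := Rp A22 *m A33 in
  let C4 := A33 in
  let D := Lp B11 *m Lp N1 in
  let D1 := B33 in
  let D2 := B33 *m Lp B22 in
  let D3 := B33 *m Lp B11 in
  let D4 := B33 *m D in
  let E1 := C *m T1 in
  let E2 := Rp A11 *m T1 *m Lp B22 in
  let E3 := Rp A22 *m T1 *m Lp B11 in
  let E4 := T1 *m D in
  let C11 := row_mx (Lp C2) (Lp C4) in
  let D11 := col_mx (Rp D1) (Rp D3) in
  let D22 := Rp D2 in
  let C33 := Lp C3 in
  let E22 := Rp C11 *m C33 in
  let E33 := D22 *m Lp D11 in
  let F1 := mpinv C1 *m E1 *m mpinv D1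
            + Lp C1 *m mpinv C2 *m E2 *m mpinv D2 in
  let F2 := mpinv C3 *m E3 *m mpinv D3
            + Lp C3 *m mpinv C4 *m E4 *m mpinv D4 in
  let F := F2 - F1 in
  let E := Rp C11 *m F *m Lp D11 in
  let consistent :=
    exists (X1 : 'M[quat R]_(p1, n)) (X2 : 'M[quat R]_(m, s1))
           (Y1 : 'M[quat R]_(p2, s2)) (Y2 : 'M[quat R]_(p3, s3))
           (Y3 : 'M[quat R]_(p4, s4)),
      A1 *m X1 + X2 *m B1 + A2 *m Y1 *m B2 + A3 *m Y2 *m B3
        + A4 *m Y3 *m B4 = B in
  let projector_conditions :=
    (Rp C1 *m E1 = 0 /\ E1 *m Lp D1 = 0) /\
    (Rp C2 *m E2 = 0 /\ E2 *m Lp D2 = 0) /\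
    (Rp C3 *m E3 = 0 /\ E3 *m Lp D3 = 0) /\
    (Rp C4 *m E4 = 0 /\ E4 *m Lp D4 = 0) /\
    Rp E22 *m E *m Lp E33 = 0 in
  let rank_conditions :=
    qrank (block_mx B  (row_mx A2 (row_mx A3 (row_mx A4 A1)))
                    B1 0)
      = (qrank B1 + qrank (row_mx A2 (row_mx A3 (row_mx A4 A1))))%N /\
    qrank (block_mx B                 (row_mx A2 (row_mx A4 A1))
                    (col_mx B3 B1)    0)
      = (qrank (row_mx A2 (row_mx A4 A1)) + qrank (col_mx B3 B1))%N /\
    qrank (block_mx B                 (row_mx A3 (row_mx A4 A1))
                    (col_mx B2 B1)    0)
      = (qrank (row_mx A3 (row_mx A4 A1)) + qrank (col_mx B2 B1))%N /\
    qrank (block_mx B                          (row_mx A4 A1)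
                    (col_mx B2 (col_mx B3 B1)) 0)
      = (qrank (col_mx B2 (col_mx B3 B1)) + qrank (row_mx A4 A1))%N /\
    qrank (block_mx B                 (row_mx A2 (row_mx A3 A1))
                    (col_mx B4 B1)    0)
      = (qrank (row_mx A2 (row_mx A3 A1)) + qrank (col_mx B4 B1))%N /\
    qrank (block_mx B                          (row_mx A2 A1)
                    (col_mx B3 (col_mx B4 B1)) 0)
      = (qrank (col_mx B3 (col_mx B4 B1)) + qrank (row_mx A2 A1))%N /\
    qrank (block_mx B                          (row_mx A3 A1)
                    (col_mx B2 (col_mx B4 B1)) 0)
      = (qrank (col_mx B2 (col_mx B4 B1)) + qrank (row_mx A3 A1))%N /\
    qrank (block_mx B                                      A1
                    (col_mx B2 (col_mx B3 (col_mx B4 B1))) 0)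
      = (qrank (col_mx B2 (col_mx B3 (col_mx B4 B1))) + qrank A1)%N /\
    qrank
      (col_mx (row_mx B  (row_mx A2 (row_mx A1 (row_mx 0     (row_mx 0  (row_mx 0  A4))))))
      (col_mx (row_mx B3 (row_mx 0  (row_mx 0  (row_mx 0     (row_mx 0  (row_mx 0  0))))))
      (col_mx (row_mx B1 (row_mx 0  (row_mx 0  (row_mx 0     (row_mx 0  (row_mx 0  0))))))
      (col_mx (row_mx 0  (row_mx 0  (row_mx 0  (row_mx (- B) (row_mx A3 (row_mx A1 A4))))))
      (col_mx (row_mx 0  (row_mx 0  (row_mx 0  (row_mx B2    (row_mx 0  (row_mx 0  0))))))
      (col_mx (row_mx 0  (row_mx 0  (row_mx 0  (row_mx B1    (row_mx 0  (row_mx 0  0))))))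
              (row_mx B4 (row_mx 0  (row_mx 0  (row_mx B4    (row_mx 0  (row_mx 0  0))))))))))))
      = (qrank (col_mx (row_mx B3 0)
               (col_mx (row_mx B1 0)
               (col_mx (row_mx 0  B2)
               (col_mx (row_mx 0  B1)
                       (row_mx B4 B4)))))
         + qrank (col_mx (row_mx A2 (row_mx A1 (row_mx 0  (row_mx 0  A4))))
                         (row_mx 0  (row_mx 0  (row_mx A3 (row_mx A1 A4))))))%N in
  (consistent <-> projector_conditions) /\
  (projector_conditions <-> rank_conditions).
Proof.
move=> A11 A22 A33 B11 B22 B33 N1 M1 T1 C C1 C2 C3 C4 D D1 D2 D3 D4 E1 E2 E3 E4.
move=> C11 D11 D22 C33 E22 E33 F1 F2 F E.
move=> consistent projector_conditions rank_conditions.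
have rpE k l (X : 'M[quat R]_(k, l)) : Rp X = 1%:M - X *m mpinv X by [].
have lpE k l (X : 'M[quat R]_(k, l)) : Lp X = 1%:M - mpinv X *m X by [].
pose range_cond := range_conditions (@Rp R) (@Lp R) A33 B33 C1 C2 C3 D2 D3 D4
  E1 E2 E3 E4.
have consistentE : consistent <-> range_cond /\ Rp E22 *m E *m Lp E33 = 0.
  exact: (consistentP (@mpinvK R) rpE lpE (erefl A11) (erefl A22) (erefl A33)
    (erefl B11) (erefl B22) (erefl B33) (erefl N1) (erefl M1) (erefl T1)
    (erefl C) (erefl C1) (erefl C2) (erefl C3) (erefl D) (erefl D2) (erefl D3)
    (erefl D4) (erefl E1) (erefl E2) (erefl E3) (erefl E4)).
have projectorE : projector_conditions <->
    range_cond /\ Rp E22 *m E *m Lp E33 = 0.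
  split=> [[h1 [h2 [h3 [h4 h9]]]]|[[h1 [h2 [h3 h4]]] h9]].
    exact: (conj (conj h1 (conj h2 (conj h3 h4))) h9).
  exact: (conj h1 (conj h2 (conj h3 (conj h4 h9)))).
rewrite consistentE projectorE; split=> //.
have rangeE := range_conditions_blocks (@mpinvK R) rpE lpE (erefl A11)
  (erefl A22) (erefl A33) (erefl B11) (erefl B22) (erefl B33) (erefl N1)
  (erefl M1) (erefl T1) (erefl C) (erefl C1) (erefl C2) (erefl C3) (erefl D)
  (erefl D2) (erefl D3) (erefl D4) (erefl E1) (erefl E2) (erefl E3) (erefl E4).
have compatE := compatibility_block (@mpinvK R) rpE lpE (erefl A11)
  (erefl A22) (erefl A33) (erefl B11) (erefl B22) (erefl B33) (erefl T1)
  (erefl C) (erefl C1) (erefl C2) (erefl C3) (erefl D)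
  (erefl D2) (erefl D3) (erefl D4) (erefl E1) (erefl E2) (erefl E3) (erefl E4).
rewrite /rank_conditions qrank_interleave !qrank_block_eq !qrank_block_eqC.
rewrite -/range_cond in rangeE compatE.
(* The ninth rank equality is matched with the last projector condition under the range conditions,
   which make F1 and F2 solve their equations; the other eight are therefore converted first. *)
split=> [[rc9 h9]|].
  have [h1 [h2 [h3 [h4 [h5 [h6 [h7 h8]]]]]]] := (rangeE.1 rc9).
  exact: (conj h1 (conj h2 (conj h3 (conj h4 (conj h5 (conj h6 (conj h7
    (conj h8 ((compatE rc9).1 h9))))))))).
case=> h1 [h2 [h3 [h4 [h5 [h6 [h7 [h8 h9]]]]]]].
have rc9 : range_cond := (rangeE.2 (conj h1 (conj h2 (conj h3 (conj h4
    (conj h5 (conj h6 (conj h7 h8)))))))).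
exact: (conj rc9 ((compatE rc9).2 h9)).
Qed.
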